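(* Let $F$ and $F'$ be finitely generated free groups. Then the direct product $F\times F'$ is a systolic group.
   Context: A generalised simplicial complex (called ''simplicial complex'' here) is a set of affine simplices together with a set, closed under composition, of affine embeddings (attaching maps) of simplices onto faces of simplices, such that for each proper face of each simplex there is precisely one attaching map onto it; the geometric realisation is the quotient (simplices need not be embedded). The link of a simplex $\sigma$ has one simplex for each attaching map of $\sigma$ onto a proper face of a simplex $\tau$, namely the face of $\tau$ spanned by the vertices not in the image of $\sigma$, with the restricted attaching maps. A simplicial complex is simple if it has no edge joining a vertex to itself and no two distinct simplices of positive dimension with the same boundary. A simple complex is flag if every finite clique of its $1$-skeleton spans a simplex. A cycle without diagonals is an embedded simplicial loop such that no edge of the complex connects two nonconsecutive vertices of it. A simplicial complex is locally $6$-large if all its vertex links are (simple and) flag and contain no cycles of length $4$ or $5$ without diagonals. A systolic complex is a (nonempty) connected, simply connected locally $6$-large simplicial complex. A group is systolic if it acts geometrically (properly and cocompactly, by simplicial automorphisms) on a systolic complex. *)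

(* Defs.v *)
From HB Require Import structures.
From mathcomp Require Import all_boot all_order all_algebra.
From mathcomp Require Import generic_quotient.
From mathcomp Require Import all_classical all_reals all_analysis.
From Stdlib Require Import Relation_Operators.
Import Order.TTheory GRing.Theory Num.Theory numFieldNormedType.Exports.

Set Implicit Arguments.
Unset Strict Implicit.
Unset Printing Implicit Defensive.

Local Open Scope classical_set_scope.
Local Open Scope ring_scope.
Local Open Scope quotient_scope.

(* An affine simplex is encoded by its finite nonempty set of vertices, and an
   affine embedding of a simplex onto a face by the injective map it induces on
   vertices.  Attaching maps are the embeddings onto *proper* faces; a proper
   face of t is a set of vertices of t other than the empty and the full one. *)
Record gscomplex := GSComplex {
  simp :> choiceType;
  vert : simp -> finType;
  att : forall s t : simp, pred {ffun vert s -> vert t};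
  vert_gt0 : forall s, (0 < #|vert s|)%N;
  att_inj : forall s t (f : {ffun vert s -> vert t}), att f -> injective f;
  att_proper : forall s t (f : {ffun vert s -> vert t}), att f ->
    exists w, w \notin codom f;
  att_comp : forall s t u (f : {ffun vert s -> vert t})
      (g : {ffun vert t -> vert u}),
    att f -> att g -> att [ffun v => g (f v)];
  att_unique : forall t (A : {set vert t}), A != finset.set0 ->
    A != finset.setT ->
    exists! p : {s : simp & {ffun vert s -> vert t}},
      att (tagged p) /\ codom (tagged p) =i A }.

Arguments vert {_} s.
Arguments att {_ s t} f.

Section Link.
Variables (X : gscomplex) (s : X).

Definition link_simp : Type :=
  {t : X & {f : {ffun vert s -> vert t} | att f}}.
HB.instance Definition _ := Choice.on link_simp.

Definition link_map (p : link_simp) : {ffun vert s -> vert (tag p)} :=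
  val (tagged p).

Definition link_vert (p : link_simp) : finType :=
  {v : vert (tag p) | v \notin codom (link_map p)}.

Definition link_att (p q : link_simp) :
    pred {ffun link_vert p -> link_vert q} :=
  fun r => [exists h : {ffun vert (tag p) -> vert (tag q)},
    [&& att h, [forall v, h (link_map p v) == link_map q v]
      & [forall w, val (r w) == h (val w)]]].

Lemma link_attP p q (r : {ffun link_vert p -> link_vert q}) :
  reflect (exists h : {ffun vert (tag p) -> vert (tag q)},
    [/\ att h, forall v, h (link_map p v) = link_map q v
      & forall w, val (r w) = h (val w)]) (link_att r).
Proof.
apply: (iffP existsP) => -[h].
  by case/and3P=> ah /forallP H1 /forallP H2; exists h; split=> // v; apply/eqP.
case=> ah H1 H2; exists h; rewrite ah /=.
by apply/andP; split; apply/forallP => v; rewrite ?H1 ?H2.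
Qed.

Fact link_vert_gt0 p : (0 < #|link_vert p|)%N.
Proof.
case: p => t [f af]; have [w wf] := att_proper af.
by apply/card_gt0P; exists (exist _ w wf).
Qed.

Fact link_att_inj p q (r : {ffun link_vert p -> link_vert q}) :
  link_att r -> injective r.
Proof.
case/link_attP=> h [ah _ H] v w /(congr1 val); rewrite !H => E.
exact/val_inj/(att_inj ah).
Qed.

Fact link_att_proper p q (r : {ffun link_vert p -> link_vert q}) :
  link_att r -> exists w, w \notin codom r.
Proof.
case/link_attP=> h [ah H1 H2]; have [w wh] := att_proper ah.
have wq : w \notin codom (link_map q).
  by apply: contra wh => /codomP[v ->]; rewrite -H1 codom_f.
exists (exist _ w wq); apply: contra wh => /codomP[v /(congr1 val)].
by rewrite H2 /= => ->; rewrite codom_f.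
Qed.

Fact link_att_comp p q u (f : {ffun link_vert p -> link_vert q})
    (g : {ffun link_vert q -> link_vert u}) :
  link_att f -> link_att g -> link_att [ffun v => g (f v)].
Proof.
case/link_attP=> h [ah H1 H2] /link_attP[k [ak K1 K2]].
apply/link_attP; exists [ffun v => k (h v)]; split; first exact: att_comp.
  by move=> v; rewrite ffunE H1 K1.
by move=> w; rewrite !ffunE K2 H2.
Qed.

Fact link_att_unique q (A : {set link_vert q}) : A != finset.set0 ->
  A != finset.setT ->
  exists! p : {p : link_simp & {ffun link_vert p -> link_vert q}},
    link_att (tagged p) /\ codom (tagged p) =i A.
Proof.
move=> A0 AT.
pose f' := link_map q; have af' : att f' := valP (tagged q).
pose B : {set vert (tag q)} :=
  [set w | (w \in codom f') || [exists a in A, w == val a]]%SET.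
have BP w : (w \in B) = (w \in codom f') || [exists a in A, w == val a].
  by rewrite inE.
have valB (a : link_vert q) : (val a \in B) = (a \in A).
  rewrite BP (negbTE (valP a)) /=; apply/existsP/idP.
    by case=> b /andP[bA /eqP/val_inj ->].
  by move=> aA; exists a; rewrite aA eqxx.
have [a0 a0A] : exists a, a \in A by apply/finset.set0Pn.
have [b0 b0A] : exists b, b \notin A.
  have : ~~ (finset.setT \subset A) by rewrite finset.subTset.
  by case/subsetPn=> b _ bA; exists b.
have B0 : B != finset.set0.
  by apply/finset.set0Pn; exists (val a0); rewrite valB.
have BT : B != finset.setT.
  by apply: contra b0A => /eqP E; rewrite -valB E finset.in_setT.
have [[t h] [/= [ah hB] hU]] := att_unique B0 BT.
pose C : {set vert t} := [set v | h v \in codom f']%SET.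
have f'h v : f' v \in codom h by rewrite hB BP codom_f.
have [v0 _] := card_gt0P (vert_gt0 s).
have C0 : C != finset.set0.
  have /codomP[c Ec] := f'h v0; apply/finset.set0Pn; exists c.
  by rewrite inE -Ec codom_f.
have /codomP[c0 Ec0] : val a0 \in codom h by rewrite hB valB.
have CT : C != finset.setT.
  apply/eqP => E; have := finset.in_setT c0; rewrite -E inE -Ec0.
  exact/negP/(valP a0).
have [[s1 k] [/= [ak kC] _]] := att_unique C0 CT.
pose D : {set vert (tag q)} := [set w | w \in codom f']%SET.
have D0 : D != finset.set0.
  by apply/finset.set0Pn; exists (f' v0); rewrite inE codom_f.
have DT : D != finset.setT.
  apply/eqP => E; have := finset.in_setT (val a0); rewrite -E inE.
  exact/negP/(valP a0).
have [p0 [_ DU]] := att_unique D0 DT.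
have E1 : p0 = existT _ s1 [ffun v => h (k v)].
  apply: DU; split=> /=; first exact: att_comp.
  move=> w; rewrite inE; apply/codomP/idP.
    case=> v ->; rewrite ffunE.
    by have := codom_f k v; rewrite kC inE.
  case/codomP=> v ->; have /codomP[c Ec] := f'h v.
  have : c \in C by rewrite inE -Ec codom_f.
  by rewrite -kC => /codomP[u Eu]; exists u; rewrite ffunE -Eu.
have E2 : p0 = existT _ s f'.
  by apply: DU; split=> //= w; rewrite inE.
have [f [af hf]] : exists f : {ffun vert s -> vert t},
    att f /\ forall v, h (f v) = f' v.
  have E : existT (fun s0 => {ffun vert s0 -> vert (tag q)}) s1
      [ffun v => h (k v)] = existT _ s f' by rewrite -E1 E2.
  have Es : s = s1 by move: (congr1 (@tag _ _) (esym E)).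
  move: Es k ak kC E {E1}; case: s1 / => k ak kC E.
  exists k; split=> // v.
  by have /ffunP/(_ v) := eq_from_Tagged E; rewrite ffunE.
pose p : link_simp := existT _ t (exist _ f af).
have rP (w : link_vert p) : h (val w) \notin codom f'.
  apply/negP => /codomP[v]; rewrite -hf => /(att_inj ah) E.
  by have := valP w; rewrite E /link_map /= codom_f.
pose r : {ffun link_vert p -> link_vert q} := [ffun w => exist _ (h (val w)) (rP w)].
exists (existT _ p r); split=> /=.
  split.
    apply/link_attP; exists h; split=> //.
    by move=> w; rewrite ffunE.
  move=> a; apply/codomP/idP.
    case=> w Ea; rewrite -valB Ea ffunE /= -hB codom_f //.
  rewrite -valB -hB => /codomP[w Ew].
  have wf : w \notin codom (link_map p).
    apply/negP => /codomP[v]; rewrite /link_map /= => E.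
    by have := valP a; rewrite Ew E hf codom_f.
  by exists (exist _ w wf); apply: val_inj; rewrite ffunE.
case=> [[t2 [f2 af2]] r2] /= [/link_attP[h2]] + r2A.
rewrite /link_map /= in h2 * => -[ah2 H1 H2].
have E : existT (fun s0 => {ffun vert s0 -> vert (tag q)}) t h = existT _ t2 h2.
  apply: hU; split=> //= w; rewrite BP; apply/codomP/orP.
    case=> v ->; have [/codomP[u ->]|vf] := boolP (v \in codom f2).
      by left; rewrite H1 codom_f.
    right; apply/existsP; exists (r2 (exist _ v vf)).
    by rewrite -r2A codom_f; apply/eqP; rewrite [RHS]H2.
  case=> [/codomP[v ->]|/existsP[a /andP[]]].
    by exists (f2 v); rewrite H1.
  rewrite -r2A => /codomP[v ->] /eqP ->; exists (val v); exact: H2.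
have Et : t = t2 by move: (congr1 (@tag _ _) E).
move: Et f2 af2 r2 h2 ah2 H1 H2 r2A E; case: t2 / => f2 af2 r2 h2 ah2 H1 H2 r2A E.
have Eh : h = h2 := eq_from_Tagged E.
have Ef : f = f2.
  by apply/ffunP => v; apply: (att_inj ah); rewrite hf [in RHS]Eh H1.
move: Ef af2 r2 H1 H2 r2A; case: f2 / => af2 r2 H1 H2 r2A.
have Ea : af = af2 by exact: bool_irrelevance.
move: Ea r2 H1 H2 r2A; case: af2 / => r2 H1 H2 r2A.
congr existT; apply/ffunP => w; apply: val_inj.
by rewrite ffunE /= [in LHS]Eh; apply/esym/H2.
Qed.

Definition link : gscomplex :=
  GSComplex link_vert_gt0 link_att_inj link_att_proper link_att_comp
    link_att_unique.
End Link.

Section Local.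
Variable X : gscomplex.

Definition is_vertex (p : X) := #|vert p| = 1%N.

Definition vertex_of (p s : X) :=
  is_vertex p /\ (p = s \/ exists f : {ffun vert p -> vert s}, att f).

(* [p] and [q] are the two (possibly equal) ends of some edge. *)
Definition adjacent (p q : X) :=
  exists e (f : {ffun vert p -> vert e}) (g : {ffun vert q -> vert e}),
    [/\ #|vert e| = 2%N, att f, att g
      & forall w, w \in codom f \/ w \in codom g].

(* The boundary of s is the union of the (images of the) sources of the
   attaching maps into s. *)
Definition same_boundary (s t : X) := forall r : X,
  (exists f : {ffun vert r -> vert s}, att f) <->
  (exists g : {ffun vert r -> vert t}, att g).

Definition simple :=
  (forall p : X, ~ adjacent p p) /\
  (forall s t : X, (1 < #|vert s|)%N -> (1 < #|vert t|)%N ->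
     same_boundary s t -> s = t).

Definition clique (c : seq X) :=
  {in c, forall p, is_vertex p} /\
  {in c &, forall p q, p != q -> adjacent p q}.

Definition flag := simple /\
  forall c : seq X, c != [::] -> clique c ->
    exists s : X, forall p : X, vertex_of p s <-> p \in c.

Definition cycle_without_diagonals n (c : 'I_n -> X) :=
  [/\ injective c, forall i, adjacent (c i) (c (ordS i))
    & forall i j, i != j -> j != ordS i -> i != ordS j ->
        ~ adjacent (c i) (c j)].
End Local.

Definition locally_6_large (X : gscomplex) :=
  forall p : X, is_vertex p ->
    flag (link p) /\
    (forall n (c : 'I_n -> link p), n = 4%N \/ n = 5%N ->
      ~ cycle_without_diagonals c).

(* Points of the affine simplex with vertex set V, in barycentric coordinates. *)
Definition affine_simplex (R : realType) (V : finType) : set {ptws V -> R} :=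
  [set t | (forall v, 0 <= t v) /\ \sum_v t v = 1].
Arguments affine_simplex : clear implicits.

Section AffineMap.
Variables (R : realType) (V W : finType) (f : V -> W).

Definition affine_fun (t : V -> R) (w : W) : R := \sum_(v | f v == w) t v.

Fact affine_fun_simplex (t : affine_simplex R V) :
  affine_fun (val t) \in affine_simplex R W.
Proof.
have /set_mem[t0 t1] := valP t.
apply/mem_set; split=> [w|]; first exact: sumr_ge0.
rewrite -t1 [RHS](partition_big f xpredT) //=.
Qed.

Definition affine_map (t : affine_simplex R V) : affine_simplex R W :=
  exist _ (affine_fun (val t)) (affine_fun_simplex t).
End AffineMap.

Fact affine_fun_comp (R : realType) (U V W : finType) (f : U -> V)
    (g : V -> W) (t : U -> R) :
  affine_fun g (affine_fun f t) = affine_fun (g \o f) t.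
Proof.
apply/funext => w; rewrite /affine_fun.
rewrite [RHS](partition_big f (fun v => g v == w)) //=.
apply: eq_bigr => v /eqP gv; apply: eq_bigl => u.
by apply/eqP/andP => [/= ->|[_ /eqP //]]; rewrite gv !eqxx.
Qed.

Section Realisation.
Variables (R : realType) (X : gscomplex).

(* The disjoint union of the affine simplices of X. *)
Definition points : Type := {s : X & affine_simplex R (vert s) : Type}.
HB.instance Definition _ := Topological.on points.

Definition glue (x y : points) : Prop :=
  exists2 f : {ffun vert (tag x) -> vert (tag y)},
    att f & tagged y = affine_map f (tagged x).

Definition glue_equiv : rel points :=
  fun x y => `[< clos_refl_sym_trans points glue x y >].

Fact glue_equiv_refl : reflexive glue_equiv.
Proof. by move=> x; apply/asboolP/rst_refl. Qed.

Fact glue_equiv_sym : symmetric glue_equiv.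
Proof. by move=> x y; apply/asboolP/asboolP => h; exact: rst_sym. Qed.

Fact glue_equiv_trans : transitive glue_equiv.
Proof.
by move=> y x z /asboolP xy /asboolP yz; apply/asboolP; apply: rst_trans xy yz.
Qed.

Canonical glue_equiv_rel :=
  EquivRel glue_equiv glue_equiv_refl glue_equiv_sym glue_equiv_trans.

Definition realisation : topologicalType :=
  quotient_topology {eq_quot glue_equiv}.
End Realisation.

Section Homotopy.
Variables (R : realType) (T : topologicalType).
Let I : set R := `[0, 1].

Definition path_connected := forall x y : T,
  exists g : R -> T, [/\ {within I, continuous g}, g 0 = x & g 1 = y].

Definition null_homotopic (g : R -> T) := exists H : R * R -> T,
  [/\ {within I `*` I, continuous H}, {in I, forall a, H (a, 0) = g a},
      {in I, forall a, H (a, 1) = g 0}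
    & {in I, forall b, H (0, b) = g 0 /\ H (1, b) = g 0}].

Definition simply_connected := path_connected /\
  forall g : R -> T, {within I, continuous g} -> g 0 = g 1 -> null_homotopic g.
End Homotopy.

Definition systolic_complex (R : realType) (X : gscomplex) :=
  [/\ inhabited X, connected [set: realisation R X],
      simply_connected R (realisation R X) & locally_6_large X].

Section Automorphism.
Variable X : gscomplex.

Record automorphism := Automorphism {
  aut_simp :> X -> X;
  aut_vert : forall s, vert s -> vert (aut_simp s);
  aut_simp_bij : bijective aut_simp;
  aut_vert_bij : forall s, bijective (@aut_vert s);
  aut_att : forall s t (f : {ffun vert s -> vert t})
      (f' : {ffun vert (aut_simp s) -> vert (aut_simp t)}),
    (forall v, f' (aut_vert v) = aut_vert (f v)) -> att f' = att f }.

(* The action on pairs (simplex, vertex of it); equality of such pairs compares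
   automorphisms without transporting along equalities of simplices. *)
Definition aut_pair (a : automorphism) (x : {s : X & vert s}) :
    {s : X & vert s} :=
  existT _ (a (tag x)) (aut_vert a (tagged x)).

Variable R : realType.

Definition aut_point (a : automorphism) (x : points R X) : points R X :=
  existT (fun s : X => affine_simplex R (vert s) : Type)
    (a (tag x)) (affine_map (@aut_vert a (tag x)) (tagged x)).

Definition aut_real (a : automorphism) : realisation R X -> realisation R X :=
  lift_op1 {eq_quot @glue_equiv R X} (aut_point a).

Fact aut_point_glue a x y : glue x y -> glue (aut_point a x) (aut_point a y).
Proof.
case: x y => [s u] [t w] [/= f af ->].
have [i sK iK] := aut_vert_bij a s.
pose f' : {ffun vert (a s) -> vert (a t)} :=
  [ffun v => aut_vert a (f (i v))].
have f'E v : f' (aut_vert a v) = aut_vert a (f v) by rewrite ffunE sK.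
exists f' => /=; first by rewrite (aut_att f'E).
apply/val_inj/funext => z /=; rewrite !affine_fun_comp.
by apply: eq_bigl => v /=; rewrite f'E.
Qed.

(* [aut_real] does not depend on the representatives chosen by [lift_op1]. *)
Fact aut_real_pi a x :
  aut_real a (\pi_{eq_quot @glue_equiv R X} x) =
  \pi_{eq_quot @glue_equiv R X} (aut_point a x).
Proof.
rewrite /aut_real; unlock; apply/eqmodP/asboolP.
have /eqmodP/asboolP : repr (\pi_{eq_quot @glue_equiv R X} x) = x
    %[mod_eq @glue_equiv R X] by rewrite reprK.
move: (repr _) => x0; elim=> [y z yz|y|y z _ zy|y z t _ yz _ zt].
- exact/rst_step/aut_point_glue.
- exact: rst_refl.
- exact: rst_sym.
- exact: rst_trans yz zt.
Qed.
End Automorphism.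

Section Action.
Variables (G : groupType) (X : gscomplex).

Record simplicial_action := SimplicialAction {
  act :> G -> automorphism X;
  act1 : forall x, aut_pair (act 1%g) x = x;
  actM : forall g h x, aut_pair (act (g * h)%g) x =
                       aut_pair (act g) (aut_pair (act h) x) }.

Definition geometric (R : realType) (a : simplicial_action) :=
  (forall K : set (realisation R X), compact K ->
     finite_set [set g : G | (aut_real (a g) @` K) `&` K !=set0]) /\
  (exists2 K : set (realisation R X), compact K &
     \bigcup_g (aut_real (a g) @` K) = setT).
End Action.

Definition systolic_group (R : realType) (G : groupType) :=
  exists2 X : gscomplex, systolic_complex R X &
    exists a : simplicial_action G X, geometric R a.

Definition free_basis (F : groupType) (B : set F) :=
  forall (H : groupType) (phi : F -> H),
    exists! psi : F -> H,
      {morph psi : x y / (x * y)%g} /\ (forall b, B b -> psi b = phi b).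

Definition free_group (F : groupType) := exists B : set F, free_basis B.

Definition finitely_generated (F : groupType) :=
  exists s : seq F, forall A : {pred F},
    group_closed A -> {subset s <= A} -> forall x, x \in A.

(* Main.v *)
From Pilot Require Import Defs.
From HB Require Import structures.
From mathcomp Require Import all_boot all_order all_algebra.
From mathcomp Require Import generic_quotient finmap lra zify.
From mathcomp Require Import all_classical all_reals all_analysis.
From Stdlib Require Import Relation_Operators.
Import Order.TTheory GRing.Theory Num.Theory numFieldNormedType.Exports.
(* The analysis library has an unrelated [adjacent]. *)
Import Pilot.Defs.

(* A free group F acts freely on its Cayley tree, which we blow up to a tree with
   vertex set F x {0,1}, bipartite for the second coordinate; let S and S' be these
   trees for F and F'.  Let X be the flag complex whose vertices are the pairs (s, s')
   of vertices of the same colour, where (s, s') and (q, q') are adjacent if either s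
   is adjacent to q and s' to q', or s' = q' and s and q are at distance 2.  For the
   plane this is the triangulation of the square grid obtained by shifting every other
   row by a half.

   The link of (s, s') is a blow-up, with vertices replaced by cliques, of a graph
   without short cycles, because S has no closed walk of length 4 or 6 without
   backtracking.  For a choice of roots, every vertex (s, s') other than the pair of
   roots is dominated by the pair of parents (with two variants if s or s' is a root)
   among the vertices of level |s| + 3 |s'| not bigger than its own.  Hence every
   finite set of vertices lies in a finite set that can be folded to a point one
   vertex at a time, and every loop is freely null-homotopic.  Since X is locally
   finite, its realisation has the topology of the barycentric coordinates, which makes
   the homotopies explicit.  F x F' acts freely on the vertices of X, with two orbits. *)

Set Implicit Arguments.
Unset Strict Implicit.
Unset Printing Implicit Defensive.

(** * Trees and their products *)

Definition induced_cycle (V : Type) (e : rel V) n (u : 'I_n -> V) :=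
  [/\ injective u, forall i, e (u i) (u (ordS i))
    & forall i j, i != j -> j != ordS i -> i != ordS j -> ~~ e (u i) (u j)].

(** The level stands in for connectedness and acyclicity: it changes by one along edges, and every
    vertex except the root has exactly one lower neighbour. The last two fields give local
    finiteness and a neighbour of the root. *)
Record rooted_tree (S : choiceType) := RootedTree {
  tadj : rel S;
  level : S -> nat;
  root : S;
  tadj_sym : symmetric tadj;
  tadj_level : forall s t, tadj s t -> level t = (level s).+1 \/ level s = (level t).+1;
  parent_unique : forall s t u, tadj s t -> tadj s u ->
    (level t < level s)%N -> (level u < level s)%N -> t = u;
  parent_exists : forall s, s != root -> exists2 t, tadj s t & (level t < level s)%N;
  level_root : level root = 0%N;
  level0_root : forall s, level s = 0%N -> s = root;
  tadj_finite : forall s, exists l : seq S, forall t, tadj s t -> t \in l;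
  root_child : exists c, tadj root c }.

Section RootedTree.
Variables (S : choiceType) (t : rooted_tree S).
Local Notation adj := (tadj t).
Local Notation lv := (level t).
Implicit Types a b c : S.

Lemma tadj_odd a b : adj a b -> odd (lv a) = ~~ odd (lv b).
Proof. by case/tadj_level=> ->; rewrite /= ?negbK. Qed.

Lemma tadj_neq a b : adj a b -> a != b.
Proof. by move/tadj_odd=> h; apply: contra_eqN h => /eqP ->; case: odd. Qed.

(* A closed walk backtracks where its level is maximal. *)
Lemma backtrack a b c : adj b a -> adj b c -> (lv a <= lv b)%N -> (lv c <= lv b)%N ->
  a = c.
Proof.
move=> ba bc ab cb; apply: (parent_unique ba bc).
  by case/tadj_level: ba; lia.
by case/tadj_level: bc; lia.
Qed.

(** A vertex of maximal level on the closed walk has both its neighbours on the walk below it, so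
    [backtrack] applies there. *)
Lemma no_square a b c d : adj a b -> adj b c -> adj c d -> adj d a ->
  a = c \/ b = d.
Proof.
move=> ab bc cd da.
have ba : adj b a by rewrite tadj_sym.
have cb : adj c b by rewrite tadj_sym.
have dc : adj d c by rewrite tadj_sym.
have ad : adj a d by rewrite tadj_sym.
have [/tadj_level ? /tadj_level ?] := (ab, bc).
have [/tadj_level ? /tadj_level ?] := (cd, da).
have [[? ?]|[[? ?]|[[? ?]|[? ?]]]] : (lv b <= lv a /\ lv d <= lv a \/
    (lv a <= lv b /\ lv c <= lv b \/ (lv b <= lv c /\ lv d <= lv c \/
    lv c <= lv d /\ lv a <= lv d)))%N by lia.
- by right; apply: (backtrack ab ad).
- by left; apply: (backtrack ba bc).
- by right; apply: (backtrack cb cd).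
- by left; apply/esym; apply: (backtrack dc da).
Qed.

(** The walk backtracks at a vertex of maximal level. At [b], [d] or [g] this contradicts the
    distinctness of [a], [c], [f]; at [a] it is the claim; at [c] or [f] it shortens the hexagon to
    a square. *)
Lemma no_hexagon a b c d f g : adj a b -> adj b c -> adj c d -> adj d f ->
  adj f g -> adj g a -> a <> c -> c <> f -> f <> a -> b = g.
Proof.
move=> ab bc cd df fg ga ac cf fa.
have ba : adj b a by rewrite tadj_sym.
have cb : adj c b by rewrite tadj_sym.
have dc : adj d c by rewrite tadj_sym.
have fd : adj f d by rewrite tadj_sym.
have gf : adj g f by rewrite tadj_sym.
have ag : adj a g by rewrite tadj_sym.
have [/tadj_level ? /tadj_level ?] := (ab, bc).
have [/tadj_level ? /tadj_level ?] := (cd, df).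
have [/tadj_level ? /tadj_level ?] := (fg, ga).
have [[? ?]|[[? ?]|[[? ?]|[[? ?]|[[? ?]|[? ?]]]]]] : (lv b <= lv a /\ lv g <= lv a \/
    (lv a <= lv b /\ lv c <= lv b \/ (lv b <= lv c /\ lv d <= lv c \/
    (lv c <= lv d /\ lv f <= lv d \/ (lv d <= lv f /\ lv g <= lv f \/
    lv f <= lv g /\ lv a <= lv g)))))%N by lia.
- exact: (backtrack ab ag).
- by case: ac; apply: (backtrack ba bc).
- have E : b = d by apply: (backtrack cb cd).
  by rewrite -E in df; have [/esym/fa|] := no_square ab df fg ga.
- by case: cf; apply: (backtrack dc df).
- have E : d = g by apply: (backtrack fd fg).
  by rewrite E in cd; have [/ac|] := no_square ab bc cd ga.
- by case: fa; apply: (backtrack gf ga).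
Qed.
End RootedTree.

Section TreeProduct.
Variables (S S' V : choiceType) (t : rooted_tree S) (t' : rooted_tree S').
(** [V] stands for the pairs of vertices of equal colour, the colour being the parity of the level.
    The pairing [mk] is total, but constrained only on such pairs. *)
Variables (p1 : V -> S) (p2 : V -> S') (mk : S -> S' -> V).
Local Notation lv := (level t).
Local Notation lv' := (level t').
Hypothesis p_odd : forall v, odd (lv (p1 v)) = odd (lv' (p2 v)).
Hypothesis mkK : forall v, mk (p1 v) (p2 v) = v.
Hypothesis mk1 : forall s s', odd (lv s) = odd (lv' s') -> p1 (mk s s') = s.
Hypothesis mk2 : forall s s', odd (lv s) = odd (lv' s') -> p2 (mk s s') = s'.

Definition common_neighbour a b := `[< exists2 m, tadj t a m & tadj t m b >].

Definition product_adj : rel V := fun v w =>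
  (tadj t (p1 v) (p1 w) && tadj t' (p2 v) (p2 w)) ||
  [&& p2 v == p2 w, p1 v != p1 w & common_neighbour (p1 v) (p1 w)].

Local Notation e := product_adj.

Lemma product_adjP v w : reflect
  ((tadj t (p1 v) (p1 w) /\ tadj t' (p2 v) (p2 w)) \/
   [/\ p2 v = p2 w, p1 v <> p1 w &
     exists2 m, tadj t (p1 v) m & tadj t m (p1 w)]) (e v w).
Proof.
apply: (iffP orP) => -[].
- by case/andP; left.
- by case/and3P=> /eqP ? /eqP ? /asboolP; right.
- by case=> -> ->; left.
- by case=> /eqP ? /eqP ? ?; right; apply/and3P; split=> //; apply/asboolP.
Qed.

Lemma product_adj_sym : symmetric e.
Proof.
suff H v w : e v w -> e w v by move=> v w; apply/idP/idP; exact: H.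
move=> /product_adjP[[? ?]|[E N [m am mb]]]; apply/product_adjP.
  by left; split; rewrite tadj_sym.
by right; split=> //; [exact: nesym|exists m; rewrite tadj_sym].
Qed.

Lemma product_adj_irr : irreflexive e.
Proof.
move=> v; apply/negbTE/product_adjP => -[[/tadj_neq]|[]//].
by rewrite eqxx.
Qed.

Lemma product_adj_finite v : exists l : seq V, forall w, e v w -> w \in l.
Proof.
have /choice[n nP] := tadj_finite t; have /choice[n' nP'] := tadj_finite t'.
exists ([seq mk a b | a <- n (p1 v), b <- n' (p2 v)] ++
  [seq mk a (p2 v) | m <- n (p1 v), a <- n m]) => w.
rewrite mem_cat => /product_adjP[[? ?]|[E _ [m vm mw]]]; apply/orP; rewrite -(mkK w).
  by left; apply: allpairs_f; [exact: nP|exact: nP'].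
right; rewrite -E; apply/allpairsPdep; exists m, (p1 w).
by rewrite nP // nP.
Qed.

Lemma link_label v u : e v u -> exists m : S, tadj t (p1 v) m /\
  ((p1 u = m /\ tadj t' (p2 v) (p2 u)) \/
   [/\ p2 u = p2 v, tadj t m (p1 u) & p1 u <> p1 v]).
Proof.
case/product_adjP=> [[? ?]|[E N [m vm mu]]].
  by exists (p1 u); split=> //; left.
by exists m; split=> //; right; split=> //; exact: nesym.
Qed.

(* In the link of [v], the label [m] of a vertex is the neighbour of [p1 v] in the
   direction of it, and [b] tells whether it has the other colour than [v]. *)
Lemma link_adj v : exists (m : V -> S) (b : V -> bool),
  forall u w, e v u -> e v w -> u != w ->
    e u w <-> (if b u && b w then p2 u = p2 w else m u = m w).
Proof.
have /choice[m mP] : forall u, exists m, e v u -> tadj t (p1 v) m /\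
  ((p1 u = m /\ tadj t' (p2 v) (p2 u)) \/
   [/\ p2 u = p2 v, tadj t m (p1 u) & p1 u <> p1 v]).
  move=> u; have [/link_label[m ?]|_] := boolP (e v u); first by exists m.
  by exists (p1 u).
pose b u := tadj t' (p2 v) (p2 u).
have irr' s : tadj t' s s = false.
  by apply: contraTF isT => /tadj_neq; rewrite eqxx.
have odd_eq a c d : tadj t a c -> tadj t a d -> tadj t c d = false.
  move=> /tadj_odd E /tadj_odd E'; apply: contraTF isT => /tadj_odd.
  by move: E; rewrite E'; case: odd; case: odd.
have odd_eq' a c d : tadj t' a c -> tadj t' a d -> tadj t' c d = false.
  move=> /tadj_odd E /tadj_odd E'; apply: contraTF isT => /tadj_odd.
  by move: E; rewrite E'; case: odd; case: odd.
have inj u w : p1 u = p1 w -> p2 u = p2 w -> u = w.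
  by move=> E1 E2; rewrite -(mkK u) -(mkK w) E1 E2.
have ab u w : e v u -> e v w -> ~~ b u -> b w -> e u w <-> m u = m w.
  move=> vu vw; have [vm] := mP u vu; have [vm'] := mP w vw.
  case=> [[wE vw']|[E _ _]]; last by rewrite /b E irr'.
  case=> [[uE vu']|[E mu uv]]; first by rewrite /b vu'.
  move=> _ _; split=> [/product_adjP[[uw _]|[E' _ _]]|mm].
  - rewrite wE in uw.
    have mv : tadj t (m w) (p1 v) by rewrite tadj_sym.
    by have [/esym/uv|] := no_square vm mu uw mv.
  - by rewrite -E' E irr' in vw'.
  apply/product_adjP; left; rewrite E; split=> //.
  by rewrite tadj_sym wE -mm.
exists m, b => u w vu vw uw; case bu : (b u); case bw : (b w) => /=.
(* Both of the other colour: [p2 u] and [p2 w] are neighbours of [p2 v], so of equal parity and not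
   adjacent. This leaves the edges with [p2 u = p2 w], for which [p1 v] is a common neighbour. *)
- split=> [/product_adjP[[_]|[]//]|E].
    by rewrite (odd_eq' _ _ _ bu bw).
  apply/product_adjP; right; split=> //.
    by move=> E'; case/eqP: uw; apply: inj.
  have [vm [[uE _]|[Eu _ _]]] := mP u vu; last by rewrite /b Eu irr' in bu.
  have [vm' [[wE _]|[Ew _ _]]] := mP w vw; last by rewrite /b Ew irr' in bw.
  by exists (p1 v); rewrite ?uE ?wE // tadj_sym.
- by rewrite product_adj_sym ab ?bw //; split=> ->.
- by apply: ab; rewrite ?bu.
(* Both of the colour of [v]: an edge closes the hexagon [p1 v], [m u], [p1 u], [x], [p1 w],
   [m w]. *)
have [vm [[uE vu']|[Eu mu uv]]] := mP u vu; first by rewrite /b vu' in bu.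
have [vm' [[wE vw']|[Ew mw wv]]] := mP w vw; first by rewrite /b vw' in bw.
have mv' : tadj t (m w) (p1 v) by rewrite tadj_sym.
have wm' : tadj t (p1 w) (m w) by rewrite tadj_sym.
split=> [/product_adjP[[_]|[_ N [x ux xw]]]|mm].
- by rewrite Eu Ew irr'.
- by apply: (no_hexagon vm mu ux xw wm' mv') => //; exact: nesym.
apply/product_adjP; right; split; first by rewrite Eu Ew.
  by move=> E'; case/eqP: uw; apply: inj => //; rewrite Eu Ew.
by exists (m u); [rewrite tadj_sym|rewrite mm].
Qed.

(** By [link_adj] and the absence of diagonals, a vertex of the cycle with [b] false has two
    neighbours with [b] true, and one with [b] true has one neighbour of each kind: otherwise its
    two neighbours share the label that makes them adjacent. So the kinds repeat with period three,
    which excludes the lengths 4 and 5. *)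
Lemma product_link_large v n (u : 'I_n -> V) : n = 4%N \/ n = 5%N ->
  (forall i, e v (u i)) -> ~ induced_cycle e u.
Proof.
have [m [b H]] := link_adj v.
move=> n45 vu [ui ue un].
have E i j : i != j -> e (u i) (u j) <->
    (if b (u i) && b (u j) then p2 (u i) = p2 (u j) else m (u i) = m (u j)).
  by move=> ij; apply: H => //; apply: contra ij => /eqP/ui ->.
have Ey i : i != ordS i ->
    (if b (u i) && b (u (ordS i)) then p2 (u i) = p2 (u (ordS i))
     else m (u i) = m (u (ordS i))).
  by move=> ij; apply/E.
have En i j : i != j -> j != ordS i -> i != ordS j ->
    ~ (if b (u i) && b (u j) then p2 (u i) = p2 (u j) else m (u i) = m (u j)).
  by move=> ij ji jj /E => /(_ ij); exact/negP/un.
case: n45 => ?; subst n.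
  pose o i (h : (i < 4)%N) := Ordinal h.
  have S0 : ordS (@o 0 isT) = @o 1 isT by exact: val_inj.
  have S1 : ordS (@o 1 isT) = @o 2 isT by exact: val_inj.
  have S2 : ordS (@o 2 isT) = @o 3 isT by exact: val_inj.
  have S3 : ordS (@o 3 isT) = @o 0 isT by exact: val_inj.
  have := En (@o 0 isT) (@o 2 isT); have := En (@o 1 isT) (@o 3 isT).
  have := Ey (@o 0 isT); have := Ey (@o 1 isT).
  have := Ey (@o 2 isT); have := Ey (@o 3 isT).
  rewrite S0 S1 S2 S3.
  move=> /(_ isT) + /(_ isT) + /(_ isT) + /(_ isT) + /(_ isT isT isT) + /(_ isT isT isT).
  case: (b (u (@o 0 isT))); case: (b (u (@o 1 isT)));
  case: (b (u (@o 2 isT))); case: (b (u (@o 3 isT))) => /=; congruence.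
pose o i (h : (i < 5)%N) := Ordinal h.
have S0 : ordS (@o 0 isT) = @o 1 isT by exact: val_inj.
have S1 : ordS (@o 1 isT) = @o 2 isT by exact: val_inj.
have S2 : ordS (@o 2 isT) = @o 3 isT by exact: val_inj.
have S3 : ordS (@o 3 isT) = @o 4 isT by exact: val_inj.
have S4 : ordS (@o 4 isT) = @o 0 isT by exact: val_inj.
have := En (@o 0 isT) (@o 2 isT); have := En (@o 1 isT) (@o 3 isT).
have := En (@o 2 isT) (@o 4 isT); have := En (@o 3 isT) (@o 0 isT).
have := En (@o 4 isT) (@o 1 isT).
have := Ey (@o 0 isT); have := Ey (@o 1 isT).
have := Ey (@o 2 isT); have := Ey (@o 3 isT); have := Ey (@o 4 isT).
rewrite S0 S1 S2 S3 S4.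
move=> /(_ isT) + /(_ isT) + /(_ isT) + /(_ isT) + /(_ isT) + /(_ isT isT isT) +
  /(_ isT isT isT) + /(_ isT isT isT) + /(_ isT isT isT) + /(_ isT isT isT).
case: (b (u (@o 0 isT))); case: (b (u (@o 1 isT)));
case: (b (u (@o 2 isT))); case: (b (u (@o 3 isT)));
case: (b (u (@o 4 isT))) => /=; congruence.
Qed.

(* The factor 3 makes a vertex drop below its neighbours towards the root of the second
   tree before it becomes dominated by the vertex above its two parents. *)
Lemma product_dismantling : exists (rank : V -> nat) (d : V -> V) (r : V),
  [/\ rank r = 0%N, forall w, w != r -> e w (d w),
    forall w, w != r -> (rank (d w) < rank w)%N &
    forall w u, w != r -> e w u -> (rank u <= rank w)%N -> u = d w \/ e (d w) u].
Proof.
have [c0 rc0] := root_child t.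
(* The parent map, with the value [c0] at the root, so that [p s] is always a neighbour of [s]. *)
have /choice[p pP] : forall s, exists q, tadj t s q /\
    (s != root t -> (lv q < lv s)%N).
  move=> s; have [->|sr] := eqVneq s (root t); first by exists c0.
  by have [q] := parent_exists sr; exists q.
have /choice[p' pP'] : forall s, exists q, s != root t' ->
    tadj t' s q /\ (lv' q < lv' s)%N.
  move=> s; have [->|sr] := eqVneq s (root t'); first by exists s.
  by have [q] := parent_exists sr; exists q.
pose r := mk (root t) (root t').
(* Over the root of the second tree the vertex moves two steps towards the root of the first.
   Elsewhere both coordinates move to their parents; if the first is at its root it moves to [c0],
   and the rank still drops, by 3 - 1. *)
pose d w := if p2 w == root t' then mk (p (p (p1 w))) (root t')
            else mk (p (p1 w)) (p' (p2 w)).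
have lvp s : s != root t -> lv s = (lv (p s)).+1.
  by move=> sr; have [/tadj_level[]] := pP s; move=> E /(_ sr); lia.
have lvp' s : s != root t' -> lv' s = (lv' (p' s)).+1.
  by move=> /pP'[/tadj_level[]]; lia.
have lv_root s : (s == root t) = (lv s == 0)%N.
  by apply/eqP/eqP => [->|/level0_root //]; exact: level_root.
have lv_root' s : (s == root t') = (lv' s == 0)%N.
  by apply/eqP/eqP => [->|/level0_root //]; exact: level_root.
have r1 : p1 r = root t by rewrite mk1 ?level_root.
have r2 : p2 r = root t' by rewrite mk2 ?level_root.
have low s q : tadj t s q -> (lv q < lv s)%N -> q = p s.
  move=> sq qs; have sr : s != root t by rewrite lv_root; lia.
  by have [sp /(_ sr) ps] := pP s; exact: (parent_unique sq sp).
have low' s q : tadj t' s q -> (lv' q < lv' s)%N -> q = p' s.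
  move=> sq qs; have sr : s != root t' by rewrite lv_root'; lia.
  by have [sp ps] := pP' s sr; exact: (parent_unique sq sp).
(* If [m] were above [s], then [s] and [q] would both be lower neighbours of [m], hence equal. *)
have via s m q : tadj t s m -> tadj t m q -> s <> q -> (lv q <= lv s)%N -> m = p s.
  move=> sm mq sq qs; have [ms|sm'] := ltnP (lv m) (lv s); first exact: low.
  case: sq; have ms : tadj t m s by rewrite tadj_sym.
  have Esm := tadj_level sm; have Emq := tadj_level mq.
  by apply: (parent_unique ms mq); lia.
have inj u w : p1 u = p1 w -> p2 u = p2 w -> u = w.
  by move=> E1 E2; rewrite -(mkK u) -(mkK w) E1 E2.
(* By colour the level of [p1 w] is even, and it is nonzero because [w] is not [r]. *)
have two w : w != r -> p2 w = root t' -> exists k, lv (p1 w) = k.+2.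
  move=> wr w2; have := p_odd w; rewrite w2 level_root /=.
  case E: (lv (p1 w)) => [|[|k]] // _; last by exists k.
  by case/eqP: wr; apply: inj; rewrite ?r1 ?r2 //; exact: level0_root.
have d1 w : p2 w = root t' -> w != r -> [/\ p1 (d w) = p (p (p1 w)),
    p2 (d w) = root t', lv (p1 w) = (lv (p (p1 w))).+1 &
    lv (p (p1 w)) = (lv (p (p (p1 w)))).+1].
  move=> w2 wr; have [k kE] := two w wr w2.
  have E1 : lv (p1 w) = (lv (p (p1 w))).+1 by apply: lvp; rewrite lv_root kE.
  have E2 : lv (p (p1 w)) = (lv (p (p (p1 w)))).+1.
    by apply: lvp; rewrite lv_root; lia.
  have o : odd (lv (p (p (p1 w)))) = odd (lv' (root t')).
    by have := p_odd w; rewrite w2 E1 E2 /= negbK.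
  by rewrite /d w2 eqxx mk1 // mk2.
have d2 w : p2 w != root t' -> p1 (d w) = p (p1 w) /\ p2 (d w) = p' (p2 w).
  move=> w2; have o : odd (lv (p (p1 w))) = odd (lv' (p' (p2 w))).
    have [/tadj_odd E _] := pP (p1 w); have [/tadj_odd E' _] := pP' _ w2.
    by have := p_odd w; rewrite E E' => /negb_inj.
  by rewrite /d (negbTE w2) mk1 // mk2.
exists (fun w => lv (p1 w) + 3 * lv' (p2 w))%N, d, r; split.
- by rewrite r1 r2 !level_root.
- move=> w wr; apply/product_adjP; have [w2|w2] := eqVneq (p2 w) (root t').
    have [-> -> E1 E2] := d1 w w2 wr; right; split=> //.
      by move=> E; move: E1; rewrite {1}E E2; lia.
    by exists (p (p1 w)); [case: (pP (p1 w))|case: (pP (p (p1 w)))].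
  have [-> ->] := d2 w w2; left; split; first by case: (pP (p1 w)).
  by case: (pP' _ w2).
- move=> w wr; have [w2|w2] := eqVneq (p2 w) (root t').
    by have [-> -> E1 E2] := d1 w w2 wr; rewrite w2; lia.
  have [-> ->] := d2 w w2; have := lvp' _ w2.
  by have [/tadj_level ? _] := pP (p1 w); lia.
move=> w u wr wu ruw.
have [->|ud] := eqVneq u (d w); [by left|right].
have neq : p1 (d w) = p1 u -> p2 (d w) = p2 u -> False.
  by move=> E1 E2; case/eqP: ud; apply: inj.
apply/product_adjP; have [w2|w2] := eqVneq (p2 w) (root t').
  have [D1 D2 E1 E2] := d1 w w2 wr.
  case/product_adjP: wu => [[/tadj_level a1 /tadj_level a2]|[E N [m wm mu]]].
    (* Here [p2 u] has level 1, so the rank grows by at least 3 - 1, against [ruw]. *)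
    by move: a2; rewrite w2 level_root => a2; move: ruw; rewrite w2 level_root; lia.
  have mE : m = p (p1 w) by apply: via wm mu N _; move: ruw; rewrite E; lia.
  right; rewrite D2 -E w2; split=> //.
    by move=> F; apply: neq; rewrite ?D2 -?E ?w2.
  by exists m; rewrite // mE D1 tadj_sym; case: (pP (p (p1 w))).
have [D1 D2] := d2 w w2; have L2 := lvp' _ w2.
have [w1p _] := pP (p1 w); have [w2p _] := pP' _ w2.
case/product_adjP: wu => [[a1 a2]|[E N [m wm mu]]].
  (* A change by one in the first level cannot make up for 3, so [p2 u] is below [p2 w]. *)
  have u2 : p2 u = p' (p2 w).
    apply: low' => //; have := tadj_level a1; have := tadj_level a2.
    by move=> ? ?; lia.
  right; rewrite D2 u2; split=> //.
    by move=> F; apply: neq; rewrite ?D2 ?u2.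
  by exists (p1 w); rewrite // D1 tadj_sym.
(* The midpoint [m] between [p1 w] and [p1 u] is the parent of [p1 w], so [d w] and [u] are adjacent
   in both coordinates. *)
left; rewrite D1 D2 -E (tadj_sym t'); split=> //.
by rewrite -(via _ _ _ wm mu N) //; move: ruw; rewrite E; lia.
Qed.

End TreeProduct.

(** * The tree of a free group *)

Local Open Scope group_scope.

Section TwistedPermutations.
Variables (W : Type) (F : groupType) (v : W -> F).

(* The permutations of [W] that become a right translation of [F] under [v]. *)
Record tperm := TPerm {
  tfun : W -> W;
  tinv : W -> W;
  tval : F;
  tfunK : cancel tfun tinv;
  tinvK : cancel tinv tfun;
  tfunE : forall w, v (tfun w) = v w * tval }.

Lemma tperm_eq a b : tfun a = tfun b -> tval a = tval b -> a = b.
Proof.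
case: a b => f f' g K K' E [h h' k L L' D] /= fh gk; subst h k.
have f'h' : f' = h' by apply/funext => w; rewrite -{1}(L' w) K.
subst h'; congr TPerm; exact: Prop_irrelevance.
Qed.

HB.instance Definition _ := gen_eqMixin tperm.
HB.instance Definition _ := gen_choiceMixin tperm.

Definition tone : tperm := @TPerm id id 1 (fun _ => erefl) (fun _ => erefl)
  (fun w => esym (mulg1 (v w))).

Fact tmulE (a b : tperm) w : v (tfun b (tfun a w)) = v w * (tval a * tval b).
Proof. by rewrite !tfunE mulgA. Qed.

Definition tmul (a b : tperm) : tperm :=
  @TPerm (tfun b \o tfun a) (tinv a \o tinv b) (tval a * tval b)
    (can_comp (@tfunK b) (@tfunK a)) (can_comp (@tinvK a) (@tinvK b)) (tmulE a b).

Fact tinvE (a : tperm) w : v (tinv a w) = v w * (tval a)^-1.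
Proof. by rewrite -[in RHS](tinvK a w) tfunE mulgK. Qed.

Definition tinverse (a : tperm) : tperm :=
  TPerm (@tinvK a) (@tfunK a) (tinvE a).

Fact tmulA : associative tmul.
Proof. by move=> a b c; apply: tperm_eq => //=; rewrite mulgA. Qed.
Fact tmul1 : left_id tone tmul.
Proof. by move=> a; apply: tperm_eq => //=; rewrite mul1g. Qed.
Fact tmulr1 : right_id tone tmul.
Proof. by move=> a; apply: tperm_eq => //=; rewrite mulg1. Qed.
Fact tmulV : left_inverse tone tinverse tmul.
Proof.
move=> a; apply: tperm_eq; last exact: mulVg.
by apply/funext => w /=; rewrite tinvK.
Qed.
Fact tmulrV : right_inverse tone tinverse tmul.
Proof.
move=> a; apply: tperm_eq; last exact: mulgV.
by apply/funext => w /=; rewrite tfunK.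
Qed.

HB.instance Definition _ := isGroup.Build tperm tmulA tmul1 tmulr1 tmulV tmulrV.
End TwistedPermutations.

(** * Reduced words and normal forms *)

Section Words.
Variable F : groupType.
Implicit Types (l : F * bool) (w : seq (F * bool)).

Definition letter l : F := if l.2 then l.1 else l.1^-1.
Definition flip l : F * bool := (l.1, ~~ l.2).

(* The head of a list is the last letter of the word. *)
Fixpoint word_val w : F := if w is l :: w' then word_val w' * letter l else 1.

Definition push l w := if w is l' :: w' then
  if l' == flip l then w' else l :: w else [:: l].

Definition reduced w := sorted (fun l l' => l' != flip l) w.

Lemma flipK : involutive flip.
Proof. by case=> x c; rewrite /flip /= negbK. Qed.

Lemma letter_flip l : letter (flip l) = (letter l)^-1.
Proof. by case: l => x []; rewrite /letter /= ?invgK. Qed.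

Lemma push_reduced l w : reduced w -> reduced (push l w).
Proof.
case: w => //= l' w; case: eqVneq => [_|ll'] /=; first exact: path_sorted.
by rewrite /reduced /= ll'.
Qed.

(** If pushing [l] removes a leading [flip l], reducedness keeps the next letter from being [l], so
    pushing [flip l] puts it back. *)
Lemma push_flip l w : reduced w -> push (flip l) (push l w) = w.
Proof.
case: w => [|l' w] /=; first by rewrite flipK eqxx.
case: (eqVneq l' (flip l)) => [->|_ _] /=; last by rewrite flipK eqxx.
by case: w => //= l'' w; rewrite /reduced /= => /andP[/negbTE ->].
Qed.

Lemma word_val_push l w : word_val (push l w) = word_val w * letter l.
Proof.
case: w => //= l' w; case: eqVneq => [->|] //=.
by rewrite letter_flip mulgVK.
Qed.
End Words.

Section NormalForm.
Variables (F : groupType) (B : set F).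
Hypothesis freeB : free_basis B.

Definition good (w : seq (F * bool)) : bool :=
  reduced w && all (fun l => `[< B l.1 >]) w.

Let word : Type := {w | good w}.

Lemma push_good l w : B l.1 -> good w -> good (push l w).
Proof.
move=> Bl /andP[rw aw]; rewrite /good push_reduced //=.
case: w aw {rw} => [|l' w] /=; first by rewrite andbT => _; exact/asboolP.
case/andP=> a1 a2; case: ifP => _ //=; rewrite a1 a2 !andbT; exact/asboolP.
Qed.

Let wpush l (Bl : B l.1) (w : word) : word :=
  exist _ (push l (val w)) (push_good Bl (valP w)).

Let push_perm b (Bb : B b) : tperm (fun w : word => word_val (val w)).
Proof.
apply: (@TPerm _ _ _ (@wpush (b, true) Bb) (@wpush (b, false) Bb) b).
- by move=> w; apply: val_inj; apply: (@push_flip F (b, true)); case/andP: (valP w).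
- by move=> w; apply: val_inj; apply: (@push_flip F (b, false)); case/andP: (valP w).
- by move=> w; rewrite /= word_val_push.
Defined.

(** Van der Waerden's argument: a basis element acts on the reduced words over [B] by pushing a
    letter, which is invertible. The universal property extends this to [F], and the normal form of
    [x] is the image of the empty word. The component [tval] records the effect on the value of a
    word. *)
Lemma normal_form_exists : exists nf : F -> seq (F * bool),
  [/\ forall x, good (nf x), nf 1 = [::], forall x, word_val (nf x) = x &
    forall x b, B b -> nf (x * b) = push (b, true) (nf x) /\
      nf (x * b^-1) = push (b, false) (nf x)].
Proof.
pose H : groupType := tperm (fun w : word => word_val (val w)).
pose phi (b : F) : H := if pselect (B b) is left Bb then push_perm Bb else 1.
have [psi [[psiM psiB] _]] := freeB phi.
pose w0 : word := exist _ [::] isT.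
have psi1 : psi 1 = 1 by apply: (mulgI (psi 1)); rewrite -psiM !mulg1.
(* The map [tval \o psi] and the identity are morphisms that agree on [B], so the uniqueness part of
   freeness identifies them. *)
have tvalE x : tval (psi x) = x.
  have [u [_ uU]] := freeB (id : F -> F).
  have E1 : u = id by apply: uU; split.
  have E2 : u = (fun x => tval (psi x)).
    apply: uU; split=> [y z|b Bb]; first by rewrite psiM.
    by rewrite psiB // /phi; case: pselect.
  by rewrite -[RHS](congr1 (@^~ x) E1) E2.
exists (fun x => val (tfun (psi x) w0)); split.
- by move=> x; exact: valP.
- by rewrite psi1.
- by move=> x; rewrite (tfunE (psi x)) /= mul1g tvalE.
move=> x b Bb; have psib : psi b = push_perm Bb.
  rewrite psiB // /phi; case: pselect => // Bb'.
  by congr push_perm; exact: Prop_irrelevance.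
have psibV : psi b^-1 = (push_perm Bb)^-1.
  by apply: (mulgI (psi b)); rewrite -psiM mulgV psi1 psib mulgV.
by rewrite !psiM psib psibV.
Qed.
End NormalForm.

(** Finitely many letters occur in the normal forms of the generators. The elements whose normal
    form uses only these form a subgroup containing the generators, hence all of [F]. As a basis
    element is its own normal form, the basis is finite. *)
Lemma finite_normal_form (F : groupType) : free_group F -> finitely_generated F ->
  exists (bs : seq F) (nf : F -> seq (F * bool)),
  [/\ forall x l, l \in nf x -> l.1 \in bs, nf 1 = [::],
    forall x, word_val (nf x) = x &
    forall x l, l.1 \in bs -> nf (x * letter l) = push l (nf x)].
Proof.
case=> B freeB [s sgen]; have [nf [nfg nf1 nfv nfp]] := normal_form_exists freeB.
have nfB x l : l \in nf x -> B l.1.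
  by have /andP[_ /allP H] := nfg x; move=> /H /asboolP.
have nfl x l : B l.1 -> nf (x * letter l) = push l (nf x).
  by case: l => b [] /= Bb; have [E1 E2] := nfp x b Bb.
have letters_push l w k : k \in push l w -> k = l \/ k \in w.
  case: w => [|l' w] /=; first by rewrite inE => /eqP; left.
  by case: ifP => _; rewrite !inE; [move=> ->; rewrite orbT; right|case/orP=> [/eqP|]; auto].
pose B0 := flatten [seq map fst (nf x) | x <- s].
pose A : {pred F} := [pred x | all (fun l => l.1 \in B0) (nf x)].
have AP x : reflect (forall l, l \in nf x -> l.1 \in B0) (x \in A) by exact: allP.
have AM w x : (forall l, l \in w -> B l.1 /\ l.1 \in B0) -> x \in A ->
    x * word_val w \in A.
  elim: w x => [|l w IH] x wB xA /=; first by rewrite mulg1.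
  have [Bl lB0] := wB l (mem_head _ _).
  rewrite mulgA; apply/AP => k; rewrite nfl // => /letters_push[->//|].
  by apply/AP: k; apply: IH => // k kw; apply: wB; rewrite inE kw orbT.
have AV w x : (forall l, l \in w -> B l.1 /\ l.1 \in B0) -> x \in A ->
    x * (word_val w)^-1 \in A.
  elim: w x => [|l w IH] x wB xA /=; first by rewrite invg1 mulg1.
  have [Bl lB0] := wB l (mem_head _ _).
  rewrite invgM mulgA; apply: IH; first by move=> k kw; apply: wB; rewrite inE kw orbT.
  apply/AP => k; rewrite -letter_flip nfl // => /letters_push[->//|].
  exact/AP.
have A_all x : x \in A.
  apply: sgen => [|y ys]; last first.
    apply/AP => l ly; apply/flattenP; exists (map fst (nf y)); first exact: map_f.
    exact: map_f.
  split; first by rewrite inE nf1.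
  move=> y z yA zA; rewrite -(nfv z); apply: AV => // l lz; split; first exact: nfB lz.
  by apply/AP: lz.
pose bs := [seq b <- B0 | `[< B b >]].
have bsP b : b \in bs <-> B b.
  rewrite mem_filter; split=> [/andP[/asboolP]//|Bb].
  apply/andP; split; first exact/asboolP.
  have /AP/(_ (b, true)) := A_all b; apply.
  by have := nfl 1 (b, true) Bb; rewrite mul1g /letter /= nf1 => ->; rewrite inE.
exists bs, nf; split=> //.
  by move=> x l /nfB /bsP.
by move=> x l /bsP; exact: nfl.
Qed.

(** * The blown-up Cayley tree *)

Section CayleyTree.
Variables (F : groupType) (bs : seq F) (nf : F -> seq (F * bool)).
Hypothesis nf_bs : forall x l, l \in nf x -> l.1 \in bs.
Hypothesis nf1 : nf 1 = [::].
Hypothesis nfK : forall x, word_val (nf x) = x.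
Hypothesis nf_push : forall x l, l.1 \in bs -> nf (x * letter l) = push l (nf x).

(* The Cayley tree, with every vertex [x] blown up to an edge from [(x, false)] to
   [(x, true)]; the edge labelled [b] goes from [(x, true)] to [(x * b, false)]. *)
Definition incident (z x : F) : bool := z^-1 * x \in 1 :: bs.

Definition cayley_adj : rel (F * bool) := fun s t =>
  match s.2, t.2 with
  | true, false => incident s.1 t.1
  | false, true => incident t.1 s.1
  | _, _ => false
  end.

(** The levels of [(x, false)] and [(x, true)], where the word is that of [x] and the root is
    [(1, false)]. A last letter [b] arrives at the [false] end from the [true] end of the shorter
    word; an inverse letter arrives at the [true] end from the [false] end. *)
Fixpoint word_level (w : seq (F * bool)) : nat * nat :=
  match w with
  | [::] => (0, 1)
  | (_, true) :: w' => ((word_level w').2.+1, (word_level w').2.+2)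
  | (_, false) :: w' => ((word_level w').1.+2, (word_level w').1.+1)
  end%N.

Definition cayley_level (s : F * bool) : nat :=
  if s.2 then (word_level (nf s.1)).2 else (word_level (nf s.1)).1.

(** At the end where the last letter arrives the parent lies across that letter, at the other end
    across the blown-up edge. The value at the root is its neighbour [(1, true)], which is not
    lower. *)
Definition cayley_parent (s : F * bool) : F * bool :=
  match nf s.1, s.2 with
  | (b, true) :: _, false => (s.1 * b^-1, true)
  | (b, false) :: _, true => (s.1 * b, false)
  | _, c => (s.1, ~~ c)
  end.

Lemma cayley_adj_sym : symmetric cayley_adj.
Proof. by move=> [x []] [y []]. Qed.

Lemma cayley_level_odd s : odd (cayley_level s) = s.2.
Proof.
have H w : odd (word_level w).1 = false /\ odd (word_level w).2.
  by elim: w => [|[b []] w [IH1 IH2]] //=; rewrite ?IH1 ?IH2.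
case: s => x []; rewrite /cayley_level /=; by case: (H (nf x)).
Qed.

Lemma nf_letter x w l : nf x = l :: w -> nf (x * letter (flip l)) = w.
Proof.
move=> E; have lb : l.1 \in bs by apply: (nf_bs (x := x)); rewrite E mem_head.
by rewrite nf_push // E /= flipK eqxx.
Qed.

Lemma incident_step z x : incident z x -> z = x \/
  exists2 b, b \in bs & x = z * b /\ z = x * b^-1.
Proof.
rewrite /incident inE => /orP[/eqP E|zx].
  by left; apply: (mulgI z^-1); rewrite E mulVg.
by right; exists (z^-1 * x) => //; rewrite invgM invgK !mulVKg.
Qed.

(** An edge that is not a blown-up vertex pushes a letter on the normal form. Without cancellation
    the level rises; with it the edge leads to the parent. Both the level condition and the
    uniqueness of parents follow. *)
Lemma cayley_adj_parent s t : cayley_adj s t ->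
  (cayley_level t = (cayley_level s).+1 \/
   cayley_level s = (cayley_level t).+1 /\ t = cayley_parent s).
Proof.
case: s t => x [] [y []] //=; rewrite /cayley_level /cayley_parent /=.
  rewrite /cayley_adj /= => /incident_step[->|[b bb [yE _]]].
    by case: (nf y) => [|[c []] w] /=; auto.
  have := nf_push x (l := (b, true)) bb; rewrite /letter /= -yE => ->.
  case E: (nf x) => [|[c []] w] /=; rewrite /flip /=; auto.
    by rewrite xpair_eqE andbF /=; left.
  rewrite xpair_eqE andbT; case: eqVneq => [->|_] /=; last by left.
  by right; rewrite yE.
rewrite /cayley_adj /= => /incident_step[<-|[b bb [_ yE]]].
  by case: (nf y) => [|[c []] w] /=; auto.
have := nf_push x (l := (b, false)) bb; rewrite /letter /= -yE => ->.
case E: (nf x) => [|[c []] w] /=; rewrite /flip /=; auto.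
  rewrite xpair_eqE andbT; case: eqVneq => [->|_] /=; last by left.
  by right; rewrite yE.
by rewrite xpair_eqE andbF /=; left.
Qed.

Lemma cayley_parent_adj s : s != (1, false) ->
  cayley_adj s (cayley_parent s) /\ (cayley_level (cayley_parent s) < cayley_level s)%N.
Proof.
have inc1 x : incident x x by rewrite /incident mulVg mem_head.
have incb x b : b \in bs -> incident x (x * b).
  by move=> bb; rewrite /incident mulKg inE bb orbT.
case: s => x []; rewrite /cayley_parent /cayley_level /cayley_adj /= => xr.
  case E: (nf x) => [|[b []] w] /=.
  - by rewrite E; split; [exact: inc1|].
  - by rewrite E; split; [exact: inc1|].
  have bb : b \in bs by apply: (nf_bs (x := x) (l := (b, false))); rewrite E mem_head.
  by split; [exact: incb|have := nf_letter E; rewrite /letter /= => ->].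
case E: (nf x) => [|[b []] w] /=.
- by move: xr; rewrite -(nfK x) E eqxx.
- have bb : b \in bs by apply: (nf_bs (x := x) (l := (b, true))); rewrite E mem_head.
  split; first by rewrite -{2}(mulgVK b x); exact: incb.
  by have := nf_letter E; rewrite /letter /= => ->.
- by rewrite E; split; [exact: inc1|].
Qed.

Definition cayley_tree : rooted_tree (F * bool)%type.
Proof.
apply: (@RootedTree _ cayley_adj cayley_level (1, false)).
- exact: cayley_adj_sym.
- by move=> s t /cayley_adj_parent[|[]]; auto.
- move=> s t u /cayley_adj_parent[->|[_ ->]]; first by lia.
  by move=> /cayley_adj_parent[->|[_ ->]] //; lia.
- by move=> s /cayley_parent_adj[]; exists (cayley_parent s).
- by rewrite /cayley_level /= nf1.
- move=> s s0; apply/eqP; apply: contraT => /cayley_parent_adj[_].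
  by rewrite s0.
- move=> [x c]; exists ([seq (x * b, false) | b <- 1 :: bs] ++
    [seq (x * b^-1, true) | b <- 1 :: bs]) => -[y d] xy.
  rewrite mem_cat; case: c d xy => [] [] // xy; apply/orP; [left|right].
    by apply/mapP; exists (x^-1 * y); rewrite ?mulVKg.
  by apply/mapP; exists (y^-1 * x); rewrite // invgM invgK mulVKg.
- by exists (1, true); rewrite /cayley_adj /= /incident mulVg mem_head.
Defined.

Lemma cayley_adj_left g s t :
  cayley_adj (g * s.1, s.2) (g * t.1, t.2) = cayley_adj s t.
Proof.
by case: s t => x [] [y []] //=; rewrite /cayley_adj /= /incident invgM !mulgA mulgVK.
Qed.
End CayleyTree.

Local Close Scope group_scope.

Local Open Scope classical_set_scope.
Local Open Scope ring_scope.
Local Open Scope quotient_scope.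

(** * Flag complexes *)

Section CliqueComplex.
Local Open Scope fset_scope.
Variables (V : choiceType) (e : rel V).

Definition is_clique (A : {fset V}) : bool :=
  (A != fset0) && all (fun u => all (fun w => (u != w) ==> e u w) A) A.

Lemma is_cliqueP (A : {fset V}) : reflect (A != fset0 /\
  forall u w, u \in A -> w \in A -> u != w -> e u w) (is_clique A).
Proof.
apply: (iffP andP) => -[A0 H]; split=> //.
  by move=> u w uA wA uw; have /allP/(_ _ uA)/allP/(_ _ wA)/implyP := H; exact.
apply/allP => u uA; apply/allP => w wA; apply/implyP; exact: H.
Qed.

Lemma is_clique1 v : is_clique [fset v].
Proof.
apply/is_cliqueP; split; first by apply/fset0Pn; exists v; rewrite inE.
by move=> u w; rewrite !inE => /eqP-> /eqP->; rewrite eqxx.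
Qed.

Definition csimp : Type := {A : {fset V} | is_clique A}.
HB.instance Definition _ := Choice.on csimp.

Definition cvert (s : csimp) : finType := val s.

(** Simplices are sets of vertices, so the only embeddings onto faces are inclusions; [s != t] makes
    the face proper. *)
Definition catt (s t : csimp) : pred {ffun cvert s -> cvert t} :=
  fun f => (s != t) && [forall v, val (f v) == val v].

Lemma cattP s t (f : {ffun cvert s -> cvert t}) :
  reflect (s != t /\ forall v, val (f v) = val v) (catt f).
Proof.
apply: (iffP andP) => -[st H]; split=> //.
  by move=> v; exact/eqP/(forallP H).
by apply/forallP => v; apply/eqP.
Qed.

Fact cvert_gt0 s : (0 < #|cvert s|)%N.
Proof.
case: s => A cA; rewrite /cvert /= -cardfE cardfs_gt0.
by case/is_cliqueP: cA.
Qed.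

Fact catt_inj s t (f : {ffun cvert s -> cvert t}) : catt f -> injective f.
Proof. by case/cattP=> _ H u w E; apply: val_inj; rewrite -!H E. Qed.

Lemma catt_fsubset s t (f : {ffun cvert s -> cvert t}) :
  catt f -> val s `<` val t.
Proof.
case/cattP=> st H; rewrite fproperEneq; apply/andP; split.
  by apply: contra st => /eqP E; apply/eqP/val_inj.
by apply/fsubsetP => v vs; have /= <- := H [` vs]; exact: fsvalP.
Qed.

Fact catt_proper s t (f : {ffun cvert s -> cvert t}) : catt f ->
  exists w, w \notin codom f.
Proof.
move=> af; have := catt_fsubset af; rewrite fproperE => /andP[_ /fsubsetPn[x xt xs]].
exists [` xt]; apply/negP => /codomP[v /(congr1 val)] /=.
by case/cattP: af => _ -> E; rewrite E (fsvalP v) in xs.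
Qed.

Fact catt_comp s t u (f : {ffun cvert s -> cvert t})
    (g : {ffun cvert t -> cvert u}) :
  catt f -> catt g -> catt [ffun v => g (f v)].
Proof.
move=> af ag; apply/cattP; split.
  apply/eqP => E; have := catt_fsubset af.
  move=> /fproper_sub_trans/(_ (fproper_sub (catt_fsubset ag))).
  by rewrite E fproperEneq eqxx.
by case/cattP: af ag => _ F /cattP[_ G] v; rewrite ffunE G F.
Qed.

Lemma fsubset_clique (A B : {fset V}) : A != fset0 -> A `<=` B ->
  is_clique B -> is_clique A.
Proof.
move=> A0 /fsubsetP AB /is_cliqueP[_ H]; apply/is_cliqueP; split=> // u w uA wA.
by apply: H; exact: AB.
Qed.

Lemma catt_exists (s t : csimp) : val s `<` val t ->
  exists f : {ffun cvert s -> cvert t}, catt f.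
Proof.
move=> /[dup] st /fproper_sub st'.
exists [ffun v => fincl st' v]; apply/cattP; split; last by move=> v; rewrite ffunE.
by apply: contraTneq st => ->; rewrite fproperEneq eqxx.
Qed.

Fact catt_unique t (A : {set cvert t}) : A != finset.set0 ->
  A != finset.setT ->
  exists! p : {s : csimp & {ffun cvert s -> cvert t}},
    catt (tagged p) /\ codom (tagged p) =i A.
Proof.
move=> /finset.set0Pn[a0 a0A] AT.
have [b0 b0A] : exists b, b \notin A.
  have : ~~ (finset.setT \subset A) by rewrite finset.subTset.
  by case/subsetPn=> b _ bA; exists b.
pose B : {fset V} := [fset val x | x : cvert t in A].
have BP (x : cvert t) : (val x \in B) = (x \in A).
  by apply/imfsetP/idP => [[y yA /val_inj ->]//|xA]; exists x.
have Bt : B `<=` val t.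
  by apply/fsubsetP => x /imfsetP[y _ ->]; exact: fsvalP.
have cB : is_clique B.
  apply: fsubset_clique Bt (valP t); apply/fset0Pn; exists (val a0).
  by rewrite BP.
pose s : csimp := exist _ B cB.
have st : val s `<` val t.
  rewrite fproperE Bt; apply/fsubsetPn.
  by exists (val b0); rewrite ?BP //; exact: fsvalP.
have [f af] := catt_exists st.
exists (existT _ s f); split=> /=.
  split=> // x; apply/codomP/idP.
    by case=> v ->; rewrite -BP; case/cattP: af => _ ->; exact: fsvalP.
  rewrite -BP => xB; exists [` xB]; apply: val_inj.
  by case/cattP: af => _ ->.
case=> s' f' /= [af' fA].
have E : s = s'.
  apply/val_inj/fsetP => x /=; apply/imfsetP/idP => /=.
    case=> y; rewrite -fA => /codomP[v ->] ->.
    by case/cattP: af' => _ ->; exact: fsvalP.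
  move=> xs; exists (f' [` xs]); first by rewrite -fA codom_f.
  by case/cattP: af' => _ ->.
case: s' / E f' af' fA => f' af' fA; congr existT.
apply/ffunP => v; apply: val_inj.
by case/cattP: af af' => _ -> /cattP[_ ->].
Qed.

Definition clique_complex : gscomplex :=
  GSComplex cvert_gt0 catt_inj catt_proper catt_comp catt_unique.

End CliqueComplex.

(** * Complexes labelled by a graph, and links *)

Section Labelled.
Local Open Scope fset_scope.
Variables (X : gscomplex) (V : choiceType) (e : rel V) (D : pred V).
(** The simplices of a link are pairs of a simplex and an attaching map, not cliques. The hypotheses
    below say that the labels identify the simplices of [X] with the nonempty cliques in [D]; for
    the link of [v], [D] is the set of neighbours of [v]. *)
Variable lab : forall s : X, vert s -> V.
Hypothesis e_sym : symmetric e.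
Hypothesis lab_inj : forall s, injective (@lab s).
Hypothesis lab_att : forall s t (f : {ffun vert s -> vert t}),
  att f <-> s <> t /\ forall v, lab (f v) = lab v.
Hypothesis lab_ext : forall s t,
  (forall u, u \in codom (@lab s) <-> u \in codom (@lab t)) -> s = t.
Hypothesis lab_edge : forall s (v w : vert s), v != w -> e (lab v) (lab w).
Hypothesis lab_dom : forall s (v : vert s), D (lab v).
Hypothesis lab_ex : forall c : seq V, c != [::] -> {in c, forall u, D u} ->
  {in c &, forall u w, u != w -> e u w} ->
  exists s, forall u, u \in codom (@lab s) <-> u \in c.

Let is_label (p : X) u := is_vertex p /\ forall v : vert p, lab v = u.

Lemma vertex_label (p : X) : is_vertex p -> exists u, is_label p u.
Proof.
move=> pv; have [v vE] := fintype1 pv.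
by exists (lab v); split=> // w; rewrite (vE w).
Qed.

Lemma label_codom p u : is_label p u -> forall w, w \in codom (@lab p) <-> w = u.
Proof.
case=> pv pu w; split; first by case/codomP=> v ->.
have [v _] := fintype1 pv.
by move=> ->; rewrite -(pu v) codom_f.
Qed.

Lemma label_unique p q u : is_label p u -> is_label q u -> p = q.
Proof. by move=> /label_codom pu /label_codom qu; apply: lab_ext => w; rewrite pu qu. Qed.

Lemma label_dom p u : is_label p u -> D u.
Proof.
move=> pu; have /codomP[v ->] : u \in codom (@lab p) by rewrite label_codom.
exact: lab_dom.
Qed.

Lemma attach_exists s t : s <> t -> {subset codom (@lab s) <= codom (@lab t)} ->
  exists f : {ffun vert s -> vert t}, att f.
Proof.
move=> st sub.
have h (v : vert s) : exists w : vert t, lab v == lab w.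
  by have /codomP[w /eqP] := sub _ (codom_f (@lab s) v); exists w.
exists [ffun v => xchoose (h v)]; apply/lab_att; split=> // v.
by rewrite ffunE -(eqP (xchooseP (h v))).
Qed.

Lemma attach_codom s t (f : {ffun vert s -> vert t}) : att f ->
  forall w, w \in codom f <-> lab w \in codom (@lab s).
Proof.
case/lab_att=> _ fE w; split=> /codomP[v vE]; first by rewrite vE fE codom_f.
apply/codomP; exists v; apply: lab_inj; by rewrite fE.
Qed.

Lemma attach_sub s t (f : {ffun vert s -> vert t}) : att f ->
  {subset codom (@lab s) <= codom (@lab t)}.
Proof. by case/lab_att=> _ fE u /codomP[v ->]; rewrite -fE codom_f. Qed.

Lemma vertex_ofP p u s : is_label p u -> vertex_of p s <-> u \in codom (@lab s).
Proof.
move=> pu; split.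
  case=> _ [<-|[f af]]; first exact/(label_codom pu).
  by apply: attach_sub af _ _; exact/(label_codom pu).
move=> us; split; first by case: pu.
have [->|/eqP ps] := eqVneq p s; [by left|right].
by apply: attach_exists => // w /(label_codom pu) ->.
Qed.

Lemma adjacent_vertexl (p q : X) : adjacent p q -> is_vertex p.
Proof.
case=> s [f] [_] [s2 /[dup] af /att_inj fi _ _].
apply/eqP; rewrite eqn_leq vert_gt0 andbT -ltnS -[2%N]s2.
have [w wf] := att_proper af.
rewrite -(card_codom fi) (cardD1 w predT) inE /= add1n ltnS.
apply/subset_leq_card/fintype.subsetP => x xf; rewrite !inE andbT.
by apply: contraNneq wf => <-.
Qed.

Lemma adjacentP (p q : X) u w : is_label p u -> is_label q w ->
  adjacent p q <-> (u != w) && e u w.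
Proof.
move=> pu qw; split.
  case=> s [f] [g] [s2 af ag fg].
  have [/= uE wE] := (attach_codom af, attach_codom ag).
  have uw : u != w.
    apply/eqP => E; suff : (#|vert s| <= 1)%N by rewrite s2.
    apply/fintype_le1P => x y; apply: lab_inj.
    have H (z : vert s) : lab z = u.
      by case: (fg z) => [/uE /(label_codom pu)//|/wE /(label_codom qw) ->].
    by rewrite !H.
  rewrite uw /=.
  have /codomP[a aE] : u \in codom (@lab s).
    by apply: (attach_sub af); exact/(label_codom pu).
  have /codomP[b bE] : w \in codom (@lab s).
    by apply: (attach_sub ag); exact/(label_codom qw).
  by rewrite aE bE in uw *; apply: lab_edge; apply: contraNneq uw => ->.
case/andP=> uw euw.
have [||x y|s sE] := @lab_ex [:: u; w] => //.
- by move=> x; rewrite !inE => /orP[]/eqP->; [exact: label_dom pu|exact: label_dom qw].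
- by rewrite !inE => /orP[]/eqP-> /orP[]/eqP->; rewrite ?eqxx // e_sym.
have /codomP[a aE] : u \in codom (@lab s) by apply/sE; rewrite inE eqxx.
have /codomP[b bE] : w \in codom (@lab s) by apply/sE; rewrite !inE eqxx orbT.
have ab : a != b by apply: contraNneq uw => E; rewrite aE bE E.
have abP (x : vert s) : x = a \/ x = b.
  have /sE := codom_f (@lab s) x.
  by rewrite !inE aE bE => /orP[]/eqP/lab_inj ->; [left|right].
have neq r x : is_label r x -> r <> s.
  move=> [r1 rx] E; rewrite E in r1 rx.
  by move/fintype1: r1 => [z zE]; rewrite (zE a) (zE b) eqxx in ab.
have [f af] : exists f : {ffun vert p -> vert s}, att f.
  apply: attach_exists (neq _ _ pu) _ => x /(label_codom pu) ->.
  by rewrite aE codom_f.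
have [g ag] : exists g : {ffun vert q -> vert s}, att g.
  apply: attach_exists (neq _ _ qw) _ => x /(label_codom qw) ->.
  by rewrite bE codom_f.
exists s, f, g; split=> // [|x].
  rewrite -finset.cardsT (_ : finset.setT = [set a; b]%SET) ?cards2 ?ab //.
  by apply/setP => x; rewrite !inE; case: (abP x) => ->; rewrite eqxx ?orbT.
case: (abP x) => ->; [left; apply/(attach_codom af)|right; apply/(attach_codom ag)].
  by rewrite -aE; exact/(label_codom pu).
by rewrite -bE; exact/(label_codom qw).
Qed.

(** An edge carries two distinct labels. Every vertex of a simplex of positive dimension is a proper
    face, so the boundary determines the labels, and these determine the simplex. *)
Lemma labelled_simple : simple X.
Proof.
split=> [p pp|s t s1 t1 st].
  have [u pu] := vertex_label (adjacent_vertexl pp).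
  by have := (adjacentP pu pu).1 pp; rewrite eqxx.
have H s' t' : (1 < #|vert s'|)%N -> same_boundary s' t' ->
    {subset codom (@lab s') <= codom (@lab t')}.
  move=> s'1 st' u /codomP[v uE].
  have [||[p f] [/= [af fv] _]] := @att_unique X s' [set v]%SET.
  - by apply/finset.set0Pn; exists v; rewrite inE.
  - by apply: contraTneq s'1 => /(congr1 (fun A : {set _} => #|A|));
    rewrite cards1 finset.cardsT => <-.
  have [g ag] := (st' p).1 (ex_intro _ f af).
  apply: (attach_sub ag).
  by rewrite uE; apply/(attach_codom af); rewrite fv inE.
apply: lab_ext => u; split; apply: H => // r; exact: iff_sym.
Qed.

Lemma labelled_flag : flag X.
Proof.
split; first exact: labelled_simple.
move=> c c0 [cv cadj].
have [L LP] : exists L : X -> V, {in c, forall p, is_label p (L p)}.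
  have [v0] : inhabited V.
    case: c c0 cv {cadj} => // p c _ /(_ p (mem_head _ _)) /vertex_label[u _].
    exact: (inhabits u).
  have /choice[L LP] : forall p, exists u, p \in c -> is_label p u.
    by move=> p; have [/cv/vertex_label[u ?]|_] := boolP (p \in c); [exists u|exists v0].
  by exists L => p /LP.
have [||x y|s sE] := @lab_ex (map L c).
- by case: (c) c0.
- by move=> x /mapP[p pc ->]; exact: label_dom (LP p pc).
- move=> /mapP[p pc ->] /mapP[q qc ->] xy.
  have : adjacent p q by apply: cadj => //; apply: contraNneq xy => ->.
  by move/(adjacentP (LP p pc) (LP q qc)) => /andP[].
exists s => p; split=> [ps|pc].
  have [u pu] : exists u, is_label p u by apply: vertex_label; case: ps.
  have := (vertex_ofP _ pu).1 ps => /sE /mapP[q qc uE].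
  have qu : is_label q u by rewrite uE; exact: LP.
  by rewrite (label_unique pu qu).
apply/(vertex_ofP _ (LP p pc))/sE; exact: map_f.
Qed.

Lemma labelled_cycle n (c : 'I_n -> X) : cycle_without_diagonals c ->
  exists2 u : 'I_n -> V, (forall i, D (u i)) & induced_cycle e u.
Proof.
case=> ci cadj cdiag.
have /choice[u uP] : forall i, exists u, is_label (c i) u.
  by move=> i; apply: vertex_label; exact: adjacent_vertexl (cadj i).
exists u; first by move=> i; exact: label_dom (uP i).
have ui : injective u.
  move=> i j E; apply: ci; apply: label_unique (uP i) _; rewrite E; exact: uP.
split=> // [i|i j ij ji jj].
  by have /(adjacentP (uP i) (uP _))/andP[] := cadj i.
apply/negP => eij; apply: (cdiag i j) => //; apply/(adjacentP (uP i) (uP j)).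
by rewrite eij andbT; apply: contra ij => /eqP/ui ->.
Qed.
End Labelled.

Section LinkClique.
Local Open Scope fset_scope.
Variables (V : choiceType) (e : rel V).
Hypothesis e_sym : symmetric e.
Hypothesis e_irr : irreflexive e.
Let X := clique_complex e.

Lemma clique_vertex (p : X) : is_vertex p -> exists v, val p = [fset v].
Proof.
move=> p1; apply/cardfs1P; rewrite cardfE; exact/eqP.
Qed.

(** A simplex of the link of [v] amounts to a clique properly containing [v], as its attaching map
    is an inclusion. Its vertices are labelled by the elements other than [v], and a clique [c] of
    neighbours comes from the simplex on [v] and [c]. *)
Lemma clique_link_flag (p : X) : is_vertex p -> flag (link p) /\
  forall n (c : 'I_n -> link p), cycle_without_diagonals c ->
  exists v, exists2 u : 'I_n -> V, (forall i, e v (u i)) & induced_cycle e u.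
Proof.
move=> /clique_vertex[v pv].
pose lab (q : link p) (w : vert q) : V := val (val w : vert (tag q)).
have attv q : codom (@link_map X p q) =i [pred w | val w == v].
  move=> w; rewrite inE; have /cattP[_ H] := valP (tagged q).
  apply/codomP/eqP => [[z ->]|wv].
    by rewrite /link_map H; apply/eqP; rewrite -in_fset1 -pv; exact: fsvalP.
  have vp : v \in val p by rewrite pv fset11.
  by exists [` vp]; apply: val_inj; rewrite wv /link_map H.
have lab_codom (q : link p) u : u \in codom (@lab q) <-> u \in val (tag q) /\ u != v.
  split; first case/codomP=> w ->.
    by split; [exact: fsvalP|have := valP w; rewrite attv].
  case=> uq uv; have H : [` uq] \notin codom (@link_map X p q) by rewrite attv.
  by apply/codomP; exists (exist _ [` uq] H).
have link_ext (q r : link p) : tag q = tag r -> q = r.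
  case: q r => [t [f af]] [t' [f' af']] /= E; case: t' / E f' af' => f' af'.
  have E : f = f'.
    by apply/ffunP => x; apply: val_inj; case/cattP: af af' => _ -> /cattP[_ ->].
  case: f' / E af' => af'; congr existT; congr exist; exact: bool_irrelevance.
have v_in (q : link p) : v \in val (tag q).
  have [w wq] : exists w, w \in codom (@link_map X p q).
    have [x _] := card_gt0P (vert_gt0 p); exists (link_map q x); exact: codom_f.
  by move: (wq); rewrite attv inE => /eqP <-; exact: fsvalP.
have codom_tag (q r : link p) : {subset codom (@lab q) <= codom (@lab r)} ->
    val (tag q) `<=` val (tag r).
  move=> sub; apply/fsubsetP => x xq; have [->//|xv] := eqVneq x v.
  have /sub/lab_codom[] // : x \in codom (@lab q) by apply/lab_codom.
have lab_inj (q : link p) : injective (@lab q) by move=> x y /val_inj/val_inj.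
have lab_att (q r : link p) (f : {ffun vert q -> vert r}) :
    att f <-> q <> r /\ forall w, lab _ (f w) = lab _ w.
  split.
    case/link_attP=> h [ah _ hE]; split=> [E|w].
      by case/cattP: ah => /eqP + _; rewrite E.
    by rewrite /lab hE; case/cattP: ah => _ ->.
  case=> qr fE; have sub : val (tag q) `<=` val (tag r).
    by apply: codom_tag => x /codomP[w ->]; rewrite -fE codom_f.
  have [|h ah] := @catt_exists V e (tag q) (tag r).
    rewrite fproperEneq sub andbT; apply: contra_notN qr => /eqP/val_inj.
    exact: link_ext.
  case/cattP: (ah) => _ hE.
  apply/link_attP; exists h; split=> // w; apply: val_inj; rewrite hE.
    have /cattP[_ E1] := valP (tagged q); have /cattP[_ E2] := valP (tagged r).
    by rewrite /link_map E1 E2.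
  exact: fE.
have lab_ext (q r : link p) :
    (forall u, u \in codom (@lab q) <-> u \in codom (@lab r)) -> q = r.
  move=> H; apply/link_ext/val_inj/eqP; rewrite eqEfsubset.
  by apply/andP; split; apply: codom_tag => x; apply: (H x).1 || apply: (H x).2.
have lab_edge (q : link p) (x y : vert q) : x != y -> e (lab _ x) (lab _ y).
  move=> xy; case/is_cliqueP: (valP (tag q)) => _; apply; try exact: fsvalP.
  by apply: contra xy => /eqP/val_inj/val_inj ->.
have lab_dom (q : link p) (x : vert q) : e v (lab _ x).
  case/is_cliqueP: (valP (tag q)) => _; apply; [exact: v_in|exact: fsvalP|].
  have : lab _ x \in codom (@lab q) by exact: codom_f.
  by case/lab_codom; rewrite eq_sym.
have lab_ex (c : seq V) : c != [::] -> {in c, forall u, e v u} ->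
    {in c &, forall u w, u != w -> e u w} ->
    exists q : link p, forall u, u \in codom (@lab q) <-> u \in c.
  move=> c0 cv cc; pose A : {fset V} := [fset x | x in v :: c].
  have AE x : (x \in A) = (x == v) || (x \in c) by rewrite !inE.
  have cA : is_clique e A.
    apply/is_cliqueP; split; first by apply/fset0Pn; exists v; rewrite AE eqxx.
    move=> u w; rewrite !AE => /predU1P[->|uc] /predU1P[->|wc].
    - by rewrite eqxx.
    - by move=> _; exact: cv.
    - by move=> _; rewrite e_sym; exact: cv.
    - exact: cc.
  pose t : X := exist _ A cA.
  have [|f af] := @catt_exists V e p t.
    rewrite fproperE pv fsub1set AE eqxx /=; apply/fsubsetPn.
    case: c c0 cv {cc} @A AE cA @t => // x c _ cv A AE cA t.
    exists x; rewrite ?AE ?inE ?eqxx ?orbT //; apply/eqP => xv.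
    by have := cv x (mem_head _ _); rewrite xv e_irr.
  exists (existT _ t (exist _ f af)) => u; rewrite lab_codom /= AE.
  split; first by case=> /predU1P[->|//]; rewrite eqxx.
  move=> uc; rewrite uc orbT; split=> //; apply/eqP => uv.
  by have := cv u uc; rewrite uv e_irr.
split.
  exact: (labelled_flag (e := e) (D := e v) (lab := lab)).
move=> n c cc; exists v.
exact: (labelled_cycle (e := e) (D := e v) (lab := lab)) cc.
Qed.

Lemma clique_locally_6_large :
  (forall v n (u : 'I_n -> V), n = 4%N \/ n = 5%N -> (forall i, e v (u i)) ->
     ~ induced_cycle e u) ->
  locally_6_large X.
Proof.
move=> H p /clique_link_flag[fl cyc]; split=> // n c n45 /cyc[v [u uv]].
exact: H n45 uv.
Qed.

End LinkClique.

(** * Barycentric coordinates *)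

Section Topology.
Variable R : realType.

Lemma affine_simplex_cvg (V : finType) T (F : set_system T) (FF : Filter F)
    (f : T -> affine_simplex R V) (t : affine_simplex R V) :
  (forall v, val (f a) v @[a --> F] --> val t v) -> f @ F --> t.
Proof.
move=> H U [_ [[W oW <-] Wt] sub].
have h : (fun a => val (f a) : {ptws V -> R}) @ F --> (val t : {ptws V -> R}).
  have FF' := fmap_filter (fun a => val (f a) : V -> R) FF.
  apply/cvg_sup => v.
  have surj : @^~ v @` [set: V -> R] = setT.
    by apply/seteqP; split=> // r _; exists (fun=> r).
  apply/cvg_image => // N Nv.
  exists (@^~ v @^-1` N); first exact: (H v _ Nv).
  apply/seteqP; split=> [_ [g gN <-] //|r Nr].
  by exists (fun=> r).
have hW : F (fun a => W (val (f a))) by exact: (h W (open_nbhs_nbhs (conj oW Wt))).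
by apply: (@filterS _ F FF _ _ _ hW) => a; exact: sub.
Qed.

Definition mk_affine (V : finType) (t : V -> R) (h : affine_simplex R V t) :
  affine_simplex R V := exist _ (t : {ptws V -> R}) (mem_set h).

Variables (V : choiceType) (e : rel V).
Let X := clique_complex e.
Let T := realisation R X.

Definition simplex_point (s : X) (t : affine_simplex R (vert s)) : T :=
  \pi_({eq_quot @glue_equiv R X}) (existT _ s t : points R X).

Lemma simplex_point_continuous s : continuous (@simplex_point s).
Proof.
move=> t; apply: (@continuous_comp _ (points R X) T).
  exact: existT_continuous.
exact: pi_continuous.
Qed.

(** The sum has at most one term; it is empty, hence 0, if [v] is outside the simplex, which makes
    it invariant under gluing. *)
Definition coord (v : V) (x : points R X) : R :=
  \sum_(w : vert (tag x) | val w == v) val (tagged x) w.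

Definition bary (v : V) (x : T) : R := coord v (repr x).

Lemma coord_glue v x y : glue x y -> coord v x = coord v y.
Proof.
case=> f /cattP[_ fE] E; rewrite /coord {}E /= /affine_fun.
rewrite (partition_big f (fun w => val w == v)) /=; last by move=> w; rewrite fE.
apply: eq_bigr => w /eqP wv; apply: eq_bigl => z.
by rewrite andb_idl // => /eqP fz; rewrite -wv -fz fE.
Qed.

Lemma bary_pi v (x : points R X) :
  bary v (\pi_({eq_quot @glue_equiv R X}) x) = coord v x.
Proof.
rewrite /bary; have /eqmodP/asboolP : repr (\pi_({eq_quot @glue_equiv R X}) x) = x
    %[mod_eq @glue_equiv R X] by rewrite reprK.
move: (repr _) => x0; elim=> [y z yz|y|y z _ ->|y z t _ -> _ ->] //.
exact: coord_glue.
Qed.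

Lemma bary_simplex_point v (s : X) t (w : cvert s) : val w = v ->
  bary v (@simplex_point s t) = val t w.
Proof.
move=> <-; by rewrite bary_pi /coord /= (big_pred1 w).
Qed.

Lemma bary_simplex_point_out v (s : X) t : v \notin val s ->
  bary v (@simplex_point s t) = 0.
Proof.
move=> vs; rewrite bary_pi /coord /= big1 // => z /eqP zv.
by rewrite -zv (fsvalP z) in vs.
Qed.

Lemma simplex_point_ex x : exists s t, x = @simplex_point s t.
Proof.
exists (tag (repr x)), (tagged (repr x)); rewrite /simplex_point.
by case: (repr x) (reprK x) => s t <-.
Qed.

Lemma bary_ge0 v x : 0 <= bary v x.
Proof.
have [s [t ->]] := simplex_point_ex x; rewrite bary_pi.
by apply: sumr_ge0 => w _; have /set_mem[] := valP t.
Qed.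

Lemma bary_continuous v : continuous (bary v).
Proof.
apply/quotient_continuous.
rewrite (_ : _ \o _ = coord v); last by apply/funext => x; exact: bary_pi.
rewrite (_ : coord v = unstable.sigT_fun (fun (s : X) (t : affine_simplex R (vert s)) =>
  \sum_(w : vert s | val w == v) val t w)); last by apply/funext => -[].
apply: sigT_continuous => s.
apply: continuous_big => [|w _]; first exact: add_continuous.
move=> t; apply: (@continuous_comp _ {ptws vert s -> R} R _ (fun g => g w)).
  exact: initial_continuous.
exact: (@proj_continuous _ (fun=> R) w).
Qed.

(** The support [A] of [x] is a clique contained both in [s] and in the simplex [s0] that represents
    [x]. The points of [s0] and [s] with the coordinates of [x] are glued to the same point of
    [A]. *)
Lemma simplex_point_of_support x (s : X) :
  (forall v, v \notin val s -> bary v x = 0) -> exists2 t, x = @simplex_point s t &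
  forall w : cvert s, val t w = bary (val w) x.
Proof.
have [s0 [t0 x0]] := simplex_point_ex x; move=> xs.
have [t0_ge0 t0_1] : (forall w, 0 <= val t0 w) /\ \sum_w val t0 w = 1.
  exact: set_mem (valP t0).
have baryE (w : cvert s0) : bary (val w) x = val t0 w.
  by rewrite x0 (bary_simplex_point _ (erefl (val w))).
pose A := [fset v in val s0 | bary v x != 0]%fset.
have AP v : v \in A = (v \in val s0) && (bary v x != 0) by rewrite !inE.
have As0 : (A `<=` val s0)%fset by apply/fsubsetP => v; rewrite AP => /andP[].
have As : (A `<=` val s)%fset.
  by apply/fsubsetP => v; rewrite AP => /andP[_]; apply: contraNT => /xs ->.
have cA : is_clique e A.
  apply: fsubset_clique As0 (valP s0); apply: contra_eqN t0_1 => /eqP A0.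
  rewrite big1 ?(eq_sym 0) ?oner_neq0 // => w _; apply/eqP.
  have := in_fset0 (val w); rewrite -A0 AP (fsvalP w) -baryE /=.
  by move/negbT; rewrite negbK.
pose a : X := exist _ A cA.
have bary0 v : v \notin A -> bary v x = 0.
  rewrite AP negb_and negbK => /orP[vs0|/eqP //].
  by rewrite x0 bary_simplex_point_out.
have sum_bary (s' : X) : (A `<=` val s')%fset ->
    \sum_(w : cvert s') bary (val w) x = \sum_(v <- A) bary v x.
  move=> As'; rewrite (big_fset_incl _ As'); first by rewrite big_seq_fsetE.
  by move=> v _ /bary0.
have aff (s' : X) : (A `<=` val s')%fset ->
    affine_simplex R (vert s') (fun w : cvert s' => bary (val w) x).
  move=> As'; split=> [w|]; first exact: bary_ge0.
  rewrite sum_bary // -(sum_bary s0) // -t0_1.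
  by apply: eq_bigr => w _; rewrite baryE.
have glue_a (s' : X) (h : (A `<=` val s')%fset) :
    @simplex_point s' (mk_affine (aff s' h)) =
    @simplex_point a (mk_affine (aff a (fsubset_refl A))).
  have [as'|as'] := eqVneq a s'.
    case: s' / as' h => h; congr simplex_point; exact: val_inj.
  apply/esym/eqmodP/asboolP/rst_step.
  have [|f af] := @catt_exists V e a s'.
    by rewrite fproperEneq h andbT; apply: contra as' => /eqP/val_inj ->.
  exists f => //; apply/val_inj/funext => w /=; rewrite /affine_fun /=.
  case/cattP: af => _ fE.
  have [wA|wA] := boolP (val w \in A).
    rewrite (big_pred1 [` wA]%fset) // => z /=.
    apply/eqP/eqP => E; apply: val_inj; first by rewrite -fE E.
    by rewrite fE E.
  rewrite bary0 // big1 // => z /eqP fz.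
  by rewrite -fz fE (fsvalP z) in wA.
exists (mk_affine (aff s As)) => //.
rewrite glue_a -(glue_a s0 As0); apply: (etrans x0); congr simplex_point.
by apply: val_inj; apply/funext => w /=; rewrite -baryE.
Qed.

Definition carried (s : X) (u : V -> R) := [/\ forall v, 0 <= u v,
  forall v, v \notin val s -> u v = 0 & \sum_(v <- val s) u v = 1].

Lemma carried_bary x : exists s, carried s (bary^~ x).
Proof.
have [s [t xE]] := simplex_point_ex x; exists s; split=> [v|v vs|].
- exact: bary_ge0.
- by rewrite xE bary_simplex_point_out.
have /set_mem[_ <-] := valP t; rewrite big_seq_fsetE.
by apply: eq_bigr => w _; rewrite xE (bary_simplex_point _ (erefl (val w))).
Qed.

Lemma carried_ex s u : carried s u -> exists x, bary^~ x = u.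
Proof.
case=> u0 us u1.
have h : affine_simplex R (vert s) (fun w : cvert s => u (val w)).
  by split=> //; rewrite -u1 big_seq_fsetE.
exists (@simplex_point s (mk_affine h)); apply/funext => v.
have [vs|vs] := boolP (v \in val s); last by rewrite bary_simplex_point_out ?us.
by rewrite (@bary_simplex_point v s _ [` vs]%fset).
Qed.

Lemma bary_inj x y : bary^~ x = bary^~ y -> x = y.
Proof.
move=> /funeqP xy; have [s [_ xs _]] := carried_bary x.
have [t xE tE] := simplex_point_of_support xs.
have [v|t' yE t'E] := @simplex_point_of_support y s.
  by move=> vs; rewrite -[LHS]xy; exact: xs.
rewrite xE yE; congr simplex_point; apply: val_inj; apply/funext => w.
by rewrite tE t'E; exact: xy.
Qed.

Hypothesis e_fin : forall v, exists s : seq V, forall w, e v w -> w \in s.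

Lemma star_finite v : exists s : seq X, forall t : X, v \in val t -> t \in s.
Proof.
have [n nP] := e_fin v.
pose N : {fset V} := [fset x | x in v :: n]%fset.
exists (pmap insub (fpowerset N)) => t vt.
have tN : (val t `<=` N)%fset.
  apply/fsubsetP => w wt; rewrite !inE; have [//|wv] := eqVneq w v.
  case/is_cliqueP: (valP t) => _ H; apply: nP; apply: H => //.
  by rewrite eq_sym.
rewrite mem_pmap; apply/mapP; exists (val t); first by rewrite fpowersetE.
by rewrite valK.
Qed.

(** Local finiteness is what gives the quotient topology by coordinates: a coordinate positive at
    [x] is eventually positive along [F], so only the finitely many simplices containing its vertex
    matter, and each can be treated separately. *)
Lemma bary_cvg S (F : set_system S) (FF : Filter F) (f : S -> T) (x : T) :
  (forall v, bary v (f a) @[a --> F] --> bary v x) -> f @ F --> x.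
Proof.
move=> H; have [s0 [_ _ xs0]] := carried_bary x.
have [v0 v0x] : exists v0, 0 < bary v0 x.
  apply: contrapT => /forallNP K; have := oner_neq0 R.
  rewrite -xs0 big1 ?eqxx // => v _.
  by apply/eqP; rewrite eq_le bary_ge0 leNgt !andbT; apply/negP/K.
have near_pos v : 0 < bary v x -> \forall a \near F, 0 < bary v (f a).
  by move=> vx; exact: (cvgr_gt _ (H v)).
have [ss ssP] := star_finite v0.
move=> U Ux; rewrite /= nbhs_simpl /=.
suff K (s : X) : \forall a \near F,
    (forall v, v \notin val s -> bary v (f a) = 0) -> U (f a).
  have : \forall a \near F, forall s, s \in ss ->
      (forall v, v \notin val s -> bary v (f a) = 0) -> U (f a).
    elim: ss {ssP} => [|s ss IH]; first by apply: nearW.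
    have := K s; apply: filter_app; apply: filterS IH => a IH Ks s'.
    by rewrite inE => /predU1P[->//|]; exact: IH.
  apply: filter_app; apply: filterS (near_pos _ v0x) => a av0 aP.
  have [s [_ sa _]] := carried_bary (f a).
  apply: (aP s) => //; apply: ssP; apply: contraTT av0 => /sa ->.
  by rewrite ltxx.
(* If [x] is not in [s], some coordinate outside [s] is positive at [x], so eventually no [f a] lies
   in [s]. Otherwise the comparison takes place inside the affine simplex. *)
have [xs|/existsNP[v /not_implyP[vs /eqP xv]]] :=
    pselect (forall v, v \notin val s -> bary v x = 0); last first.
  have : 0 < bary v x by rewrite lt_def xv bary_ge0.
  move/near_pos; apply: filterS => a av /(_ v vs) av0.
  by rewrite av0 ltxx in av.
have [t xt tE] := simplex_point_of_support xs.
pose D := [set a | forall v, v \notin val s -> bary v (f a) = 0].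
have /choice[g gP] : forall a, exists t' : affine_simplex R (vert s), D a ->
    f a = simplex_point t' /\ forall w : cvert s, val t' w = bary (val w) (f a).
  move=> a; have [/simplex_point_of_support[t' aE t'E]|nD] := pselect (D a).
    by exists t'.
  by exists t => /nD.
have gt : g @ within D F --> t.
  apply: affine_simplex_cvg => w; rewrite tE.
  move=> N Nx; have hN : F (fun a => N (bary (val (w : cvert s)) (f a))) by exact: H Nx.
  suff : F (fun a => D a -> N (val (g a) w)) by [].
  by apply: filterS hN => a aN aD; rewrite (gP a aD).2.
rewrite xt in Ux.
have hU : F (fun a => D a -> U (simplex_point (g a))).
  exact: gt _ (@simplex_point_continuous s t U Ux).
by apply: filterS hU => a aU aD; rewrite (gP a aD).1; exact: aU.
Qed.

End Topology.
Arguments bary {R V e} v x.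

(** * Homotopies *)

Lemma within_continuous_comp (S T U : topologicalType) (A : set S) (B : set T)
    (f : T -> U) (h : S -> T) :
  {within A, continuous h} -> (forall x, A x -> B (h x)) ->
  {within B, continuous f} -> {within A, continuous (f \o h)}.
Proof.
move=> /subspace_continuousP hc AB /subspace_continuousP fc.
apply/subspace_continuousP => x Ax W Wfx.
have := fc _ (AB _ Ax) W Wfx; rewrite /= !nbhs_simpl => K.
have := hc x Ax _ K; rewrite /= !nbhs_simpl /within /= => K'.
by apply: filterS K' => y Hy Ay; apply: (Hy Ay); exact: AB.
Qed.

Lemma pair_continuous (S T U : topologicalType) (f : S -> T) (g : S -> U) :
  continuous f -> continuous g -> continuous (fun x => (f x, g x)).
Proof. by move=> fc gc x; apply: cvg_pair; [exact: fc|exact: gc]. Qed.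

Section RealContinuity.
Variables (R : realType) (T : topologicalType).
Implicit Types f g : T -> R.

Lemma fun_continuousD f g : continuous f -> continuous g ->
  continuous (fun x => f x + g x).
Proof. by move=> fc gc x; apply: cvgD; [exact: fc|exact: gc]. Qed.

Lemma fun_continuousN f : continuous f -> continuous (fun x => - f x).
Proof. by move=> fc x; apply: cvgN; exact: fc. Qed.

Lemma fun_continuousM f g : continuous f -> continuous g ->
  continuous (fun x => f x * g x).
Proof. by move=> fc gc x; apply: cvgM; [exact: fc|exact: gc]. Qed.

Lemma fun_continuous_min f g : continuous f -> continuous g ->
  continuous (fun x => Num.min (f x) (g x)).
Proof. by move=> fc gc x; exact: (@continuous_min R T f g x (fc x) (gc x)). Qed.

Lemma fun_continuous_max f g : continuous f -> continuous g ->
  continuous (fun x => Num.max (f x) (g x)).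
Proof. by move=> fc gc x; exact: (@continuous_max R T f g x (fc x) (gc x)). Qed.
End RealContinuity.

Lemma fst_continuous (S T : topologicalType) : continuous (fst : S * T -> S).
Proof. by move=> p; exact: cvg_fst. Qed.

Lemma snd_continuous (S T : topologicalType) : continuous (snd : S * T -> T).
Proof. by move=> p; exact: cvg_snd. Qed.

Ltac solve_continuous := first
  [ by apply: fst_continuous | by apply: snd_continuous | by move=> ?; apply: cvg_cst
  | refine (pair_continuous _ _); solve_continuous
  | refine (fun_continuousD _ _); solve_continuous
  | refine (fun_continuousN _); solve_continuous
  | refine (fun_continuous_min _ _); solve_continuous
  | refine (fun_continuous_max _ _); solve_continuous
  | refine (fun_continuousM _ _); solve_continuous ].

Section FreeHomotopy.
Variables (R : realType) (T : topologicalType).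
Local Notation I := (`[0%R, 1%R]%classic : set R).

Lemma unitP (a : R) : I a <-> 0 <= a <= 1.
Proof. by rewrite /= in_itv. Qed.

(** Every stage is a loop, but the base point may move, as folding moves it. *)
Definition free_homotopic (g0 g1 : R -> T) := exists H : R * R -> T,
  [/\ {within I `*` I, continuous H}, forall a, I a -> H (a, 0) = g0 a,
      forall a, I a -> H (a, 1) = g1 a & forall b, I b -> H (0, b) = H (1, b)].

Definition paste (H1 H2 : R * R -> T) (p : R * R) : T :=
  if p.2 <= 2^-1 then H1 (p.1, 2 * p.2) else H2 (p.1, 2 * p.2 - 1).

Lemma paste_continuous H1 H2 :
  {within I `*` I, continuous H1} -> {within I `*` I, continuous H2} ->
  (forall a, I a -> H1 (a, 1) = H2 (a, 0)) ->
  {within I `*` I, continuous (paste H1 H2)}.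
Proof.
move=> c1 c2 H12.
pose A := (I `*` I) `&` [set p : R * R | p.2 <= 2^-1].
pose B := (I `*` I) `&` [set p : R * R | 2^-1 <= p.2].
have -> : I `*` I = A `|` B.
  apply/seteqP; split=> [p pI|p [[]|[]]] //.
  by case: (lerP p.2 2^-1) => h; [left|right]; split=> //; exact: ltW.
have clI : closed (I `*` I).
  have -> : I `*` I = (fst @^-1` I) `&` (snd @^-1` I) by [].
  apply: closedI; apply: preimage_closed; try exact: interval_closed.
    by move=> p _; exact: cvg_fst.
  by move=> p _; exact: cvg_snd.
apply: withinU_continuous.
- apply: closedI => //; apply: (@preimage_closed _ _ snd [set b : R | b <= 2^-1]).
    by move=> p _; exact: cvg_snd.
  exact: closed_le.
- apply: closedI => //; apply: (@preimage_closed _ _ snd [set b : R | 2^-1 <= b]).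
    by move=> p _; exact: cvg_snd.
  exact: closed_ge.
- have E : {in A, H1 \o (fun p => (p.1, 2 * p.2)) =1 paste H1 H2}.
    by move=> p /set_mem[_ /= h]; rewrite /paste h.
  apply: subspace_eq_continuous E _.
  apply: (@within_continuous_comp _ _ _ A (I `*` I)) c1.
    by apply: continuous_subspaceT; solve_continuous.
  move=> p [[/unitP p1 /unitP p2] /= h]; split; apply/unitP => /=; lra.
- have E : {in B, H2 \o (fun p => (p.1, 2 * p.2 - 1)) =1 paste H1 H2}.
    move=> p /set_mem[[p1 p2] /= h]; rewrite /paste; case: ifPn => // h'.
    have -> : p.2 = 2^-1 by apply/eqP; rewrite eq_le h h'.
    by rewrite divff // subrr H12.
  apply: subspace_eq_continuous E _.
  apply: (@within_continuous_comp _ _ _ B (I `*` I)) c2.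
    by apply: continuous_subspaceT; solve_continuous.
  move=> p [[/unitP p1 /unitP p2] /= h]; split; apply/unitP => /=; lra.
Qed.

Lemma free_homotopic_sym g0 g1 : free_homotopic g0 g1 -> free_homotopic g1 g0.
Proof.
case=> H [Hc H0 H1 Hb]; exists (H \o (fun p => (p.1, 1 - p.2))).
split=> [|a Ia|a Ia|b Ib] /=; rewrite ?subr0 ?subrr; [|exact: H1|exact: H0|].
  apply: (@within_continuous_comp _ _ _ _ (I `*` I)) Hc.
    by apply: continuous_subspaceT; solve_continuous.
  by move=> p [/= /unitP p1 /unitP p2]; split; apply/unitP => /=; lra.
by apply: Hb; move/unitP: Ib => ?; apply/unitP; lra.
Qed.

Lemma free_homotopic_trans g1 g0 g2 :
  free_homotopic g0 g1 -> free_homotopic g1 g2 -> free_homotopic g0 g2.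
Proof.
move=> [H [Hc H0 H1 Hb]] [K [Kc K0 K1 Kb]]; exists (paste H K); split.
- by apply: paste_continuous => // a Ia; rewrite H1 // K0.
- by move=> a Ia; rewrite /paste /= invr_ge0 ler0n mulr0 H0.
- move=> a Ia; rewrite /paste /= leNgt invf_lt1 ?ltr1n //= mulr1.
  by rewrite (_ : 2 - 1 = 1) ?K1 //; lra.
move=> b /unitP Ib; rewrite /paste /=; case: ifPn => h.
  by apply: Hb; apply/unitP; lra.
by apply: Kb; apply/unitP; lra.
Qed.

(** The base point moves along the path [H (0, _)]. Each stage is made a loop at [g 0] by first
    running along this path and finally returning. At the last stage only the path and its inverse
    remain, and these are contracted. *)
Lemma free_homotopic_null g c : free_homotopic g (fun=> c) -> null_homotopic g.
Proof.
case=> H [Hc H0 H1 Hb].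
pose clamp (x : R) : R := (Num.max 0 (Num.min 1 x) : R).
(* First [g] is squeezed into the middle third, with the outer thirds constant; then the middle
   third passes through the stages of [H] while the outer thirds run along the path and back. *)
pose A (p : R * R) := (clamp (p.1 * (1 + 2 * clamp (2 * p.2)) - clamp (2 * p.2)),
  Num.min (clamp (2 * p.2 - 1)) (Num.min (3 * p.1) (3 - 3 * p.1))).
(* The path followed by its inverse is drawn back to [g 0]. *)
pose B (p : R * R) := (0 : R, Num.min (1 - p.2) (Num.min (3 * p.1) (3 - 3 * p.1))).
have clampE x : 0 <= x -> x <= 1 -> clamp x = x.
  by move=> x0 x1; rewrite /clamp min_r // max_r.
have clampI x : 0 <= clamp x <= 1.
  by rewrite /clamp le_max lexx /= ge_max ler01 ge_min lexx.
have clamp0 x : x <= 0 -> clamp x = 0.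
  by move=> x0; rewrite /clamp min_r ?max_l //; lra.
have clamp1 x : 1 <= x -> clamp x = 1.
  by move=> x1; rewrite /clamp min_l ?max_r.
have minI (x a : R) : 0 <= x <= 1 -> 0 <= a <= 1 ->
    0 <= Num.min x (Num.min (3 * a) (3 - 3 * a)) <= 1.
  by move=> ? ?; rewrite !le_min ge_min; apply/andP; split; lra.
have minE (x : R) : 0 <= x -> Num.min x (Num.min (3 * 0) (3 - 3 * 0)) = 0.
  by move=> ?; rewrite mulr0 (min_l (x := 0)) ?min_r //; lra.
have minE' (x : R) : 0 <= x -> Num.min x (Num.min (3 * 1) (3 - 3 * 1)) = 0.
  by move=> ?; rewrite (min_r (x := 3 * 1)) ?min_r //; lra.
have I0 : I 0 by apply/unitP; lra.
have I1 : I 1 by apply/unitP; lra.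
have g01 : g 1 = g 0 by rewrite -!H0 // Hb.
exists (paste (H \o A) (H \o B)); split.
- apply: paste_continuous.
  + apply: (@within_continuous_comp _ _ _ _ (I `*` I)) Hc.
      by apply: continuous_subspaceT; rewrite /A /clamp; solve_continuous.
    move=> p [/= /unitP p1 /unitP p2]; split; apply/unitP; first exact: clampI.
    exact: minI.
  + apply: (@within_continuous_comp _ _ _ _ (I `*` I)) Hc.
      by apply: continuous_subspaceT; rewrite /B; solve_continuous.
    move=> p [/= /unitP p1 /unitP p2]; split; apply/unitP; first by rewrite /= lexx ler01.
    by apply: minI => //; lra.
  + move=> a /unitP Ia /=; rewrite /A /B /= mulr1 subr0.
    rewrite (clamp1 2) ?(clamp1 (2 - 1)); [|lra|lra].
    (* On the first third the two sides coincide, on the last they agree since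
       [H (0, b) = H (1, b)], and in the middle both lie in the constant stage [H (_, 1)]. *)
    have [a1|a1] := lerP (3 * a) 1; first by rewrite (clamp0 (a * _ - 1)) //; lra.
    have [a2|a2] := lerP 2 (3 * a).
      rewrite (clamp1 (a * _ - 1)) ?Hb //; first by apply/unitP; apply: minI => //; lra.
      by lra.
    rewrite (min_l (x := 1)); last by rewrite le_min; apply/andP; split; lra.
    by rewrite !H1 //; apply/unitP; exact: clampI.
- move=> a /set_mem/unitP Ia; rewrite /paste /= invr_ge0 ler0n mulr0 /A /=.
  rewrite !mulr0 (clampE 0) ?lexx ?ler01 //.
  rewrite (clamp0 (0 - 1)); last by lra.
  rewrite (min_l (x := 0)); last by rewrite le_min; apply/andP; split; lra.
  rewrite mulr0 addr0 mulr1 subr0 clampE; [|lra|lra].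
  by rewrite H0 //; apply/unitP.
- move=> a /set_mem/unitP Ia; rewrite /paste /= leNgt invf_lt1 ?ltr1n //= mulr1 /B /=.
  rewrite (min_l (x := 1 - _)); last by rewrite le_min; apply/andP; split; lra.
  by rewrite (_ : 1 - (2 - 1) = 0) ?H0 //; lra.
move=> b /set_mem/unitP Ib; rewrite /paste /A /B /=; case: ifPn => h.
  have := clampI (2 * (2 * b) - 1); have := clampI (2 * (2 * b)).
  move=> ? ?; rewrite minE ?minE'; [|lra|lra].
  by rewrite mul0r mul1r (clamp0 (0 - _)) ?(clamp1 (1 + _ - _)) ?H0 ?H1 ?g01 //; lra.
by rewrite minE ?minE' ?H0 //; lra.
Qed.

(** Applied to constant loops, the free homotopies trace paths from every point to [x0], whence path
    connectedness and connectedness. *)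
Lemma contractible_loops (x0 : T) :
  (forall g : R -> T, {within I, continuous g} -> g 0 = g 1 ->
     free_homotopic g (fun=> x0)) ->
  connected [set: T] /\ simply_connected R T.
Proof.
move=> H.
have I0 : I 0 by apply/unitP; lra.
have I1 : I 1 by apply/unitP; lra.
have pc : path_connected R T.
  move=> x y.
  have xy : free_homotopic (fun=> x) (fun=> y).
    apply: (@free_homotopic_trans (fun=> x0)).
      by apply: H => //; apply: continuous_subspaceT; exact: cst_continuous.
    apply: free_homotopic_sym.
    by apply: H => //; apply: continuous_subspaceT; exact: cst_continuous.
  case: xy => K [Kc K0 K1 _]; exists (K \o (fun b => (0, b))); split.
  - apply: (@within_continuous_comp _ _ _ _ (I `*` I)) Kc => [|b Ib //].
    apply: continuous_subspaceT; apply: pair_continuous; first exact: cst_continuous.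
    by move=> b; exact: cvg_id.
  - by rewrite /= K0.
  - by rewrite /= K1.
split; last by split=> // g gc g01; exact/free_homotopic_null/H.
rewrite (_ : [set: T] = \bigcup_(A in [set A | connected A /\ A x0]) A).
  by apply: bigcup_connected => [|A []//]; exists x0 => A [].
apply/seteqP; split=> // y _; have [g [gc g0 g1]] := pc x0 y.
exists (g @` I); last by exists 1.
split; last by exists 0.
by apply: connected_continuous_connected gc; exact: segment_connected.
Qed.

End FreeHomotopy.

(** * Dismantlable graphs and simple connectedness *)

Section Dismantling.
Variables (R : realType) (V : choiceType) (e : rel V).
Hypothesis e_fin : forall v, exists s : seq V, forall w, e v w -> w \in s.
Hypothesis e_sym : symmetric e.
Let X := clique_complex e.
Let T := realisation R X.
Local Notation I := (`[0%R, 1%R]%classic : set R).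

Lemma carried_support (x : T) : exists2 s : X, carried s (bary^~ x) &
  forall v, (v \in val s) = (0 < bary v x).
Proof.
have [s [x0 xs x1]] := carried_bary x.
pose A := [fset v in val s | 0 < bary v x]%fset.
have AP v : (v \in A) = (0 < bary v x).
  rewrite !inE /=; have [//|/xs ->] := boolP (v \in val s).
  by rewrite ltxx.
have As : (A `<=` val s)%fset by apply/fsubsetP => v; rewrite !inE => /andP[].
have A0 v : v \notin A -> bary v x = 0.
  by rewrite AP => vA; apply/eqP; rewrite eq_le x0 leNgt vA.
have A1 : \sum_(v <- A) bary v x = 1.
  by rewrite -x1; apply: big_fset_incl As _ => v _ /A0.
have cA : is_clique e A.
  apply: fsubset_clique As (valP s); apply: contra_eqN A1 => /eqP ->.
  by rewrite big_nil eq_sym oner_eq0.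
by exists (exist _ A cA : X).
Qed.

Lemma bary_within_continuous (S : topologicalType) (A : set S) (f : S -> T)
    (u : V -> S -> R) :
  (forall v, {within A, continuous u v}) ->
  (forall a v, A a -> bary v (f a) = u v a) -> {within A, continuous f}.
Proof.
move=> uc fu; apply/subspace_continuousP => a Aa.
apply: (bary_cvg e_fin) => v; rewrite fu //.
have /subspace_continuousP/(_ a Aa) := uc v.
apply: cvg_trans; apply: fmap_within_eq => b Ab /=.
by rewrite fu //; exact: set_mem.
Qed.

(** By compactness a finite set [s0] of vertices meets the support of every point of [K]. Supports
    are cliques, so they lie in [s0] together with its finitely many neighbours. *)
Lemma compact_finite_support (K : set T) : compact K ->
  exists W : seq V, forall x v, K x -> 0 < bary v x -> v \in W.
Proof.
move=> /compact_near_coveringP Kc.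
(* The properties that hold for all sufficiently large finite sets form a filter, to which the
   near-covering form of compactness applies. *)
pose F : set_system (seq V) :=
  [set P : set (seq V) | exists s0 : seq V, forall s : seq V, {subset s0 <= s} -> P s].
have FF : Filter F.
  split; first by exists [::].
    move=> P Q [s sP] [t tQ]; exists (s ++ t) => r str; split.
      by apply: sP => v vs; apply: str; rewrite mem_cat vs.
    by apply: tQ => v vt; apply: str; rewrite mem_cat vt orbT.
  by move=> P Q PQ [s sP]; exists s => r /sP /PQ.
have [s0 s0P] : F [set s : seq V | K `<=` [set x | exists2 v, v \in s & 0 < bary v x]].
  apply: (Kc _ F (fun (s : seq V) x => exists2 v, v \in s & 0 < bary v x) FF) => x Kx.
  have [s [_ _ x1] sP] := carried_support x.
  have [v vs] : exists v, v \in val s by apply/fset0Pn; case/is_cliqueP: (valP s).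
  exists ([set y | 0 < bary v y], [set s : seq V | v \in s]); last first.
    by move=> [y t] [/= ? ?]; exists v.
  split; last by exists [:: v] => t; apply; rewrite inE.
  by rewrite sP in vs; exact: (cvgr_gt _ (@bary_continuous _ _ _ v x)).
have /choice[n nP] := e_fin.
exists (s0 ++ flatten (map n s0)) => x v Kx vx.
have [v0 v0s v0x] := s0P s0 (fun _ => id) x Kx.
rewrite mem_cat; have [->|vv0] := eqVneq v v0; first by rewrite v0s.
apply/orP; right; apply/flattenP; exists (n v0); first exact: map_f.
apply: nP; have [s _ sP] := carried_support x.
by case/is_cliqueP: (valP s) => _; apply; rewrite ?sP // eq_sym.
Qed.

(** The weight of [w] is moved linearly to [w']. In a simplex with vertices in [W] that contains
    [w], every vertex other than [w'] is a neighbour of [w'], so adding [w'] gives a simplex that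
    carries the motion. *)
Lemma fold_loop (W : {fset V}) (w w' : V) (g : R -> T) :
  w != w' -> e w w' -> (forall u, u \in W -> e w u -> u = w' \/ e w' u) ->
  {within I, continuous g} -> g 0 = g 1 ->
  (forall a v, I a -> 0 < bary v (g a) -> v \in W) ->
  exists g', [/\ {within I, continuous g'}, g' 0 = g' 1,
    forall a v, I a -> 0 < bary v (g' a) -> v \in W /\ v != w \/ v = w'
    & free_homotopic g g'].
Proof.
move=> ww' eww' dom gc g01 gW.
pose u (v : V) (p : R * R) : R :=
  bary v (g p.1) + p.2 * bary w (g p.1) * ((v == w')%:R - (v == w)%:R).
have uE p : exists x : T, (I `*` I) p -> bary^~ x = u^~ p.
  have [[Ia Ib]|nI] := pselect ((I `*` I) p); last by exists (g 0).
  have [s [x0 xs x1] sP] := carried_support (g p.1).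
  have [ws|ws] := boolP (w \in val s); last first.
    exists (g p.1) => _; apply/funext => v; rewrite /u (xs w) //.
    by rewrite mulr0 mul0r addr0.
  pose A := (w' |` val s)%fset.
  have AP v : (v \in A) = (v == w') || (v \in val s) by rewrite !inE.
  have sW v : v \in val s -> v \in W by rewrite sP; exact: gW.
  have cA : is_clique e A.
    case/is_cliqueP: (valP s) => _ sc.
    have w's v : v \in val s -> v != w' -> e w' v.
      move=> vs vw'; have [->|vw] := eqVneq v w; first by rewrite e_sym.
      have ewv : e w v by apply: sc => //; rewrite eq_sym.
      by case: (dom v (sW v vs) ewv) => // E; rewrite E eqxx in vw'.
    apply/is_cliqueP; split; first by apply/fset0Pn; exists w; rewrite AP ws orbT.
    move=> x y; rewrite !AP => /predU1P[->|xs'] /predU1P[->|ys'].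
    - by rewrite eqxx.
    - by rewrite eq_sym => /(w's _ ys').
    - by rewrite e_sym => /(w's _ xs').
    - exact: sc.
  have [|x xE] := @carried_ex R V e (exist _ A cA : X) (u^~ p); last by exists x.
  have wA : w \in A by rewrite AP ws orbT.
  have w'A : w' \in A by rewrite AP eqxx.
  move: Ia Ib => /unitP Ia /unitP Ib.
  split=> /= [v|v|].
  - rewrite /u; have [->|vw] := eqVneq v w.
      rewrite (negbTE ww') sub0r mulrN1 -{1}[bary w _]mul1r -mulrBl.
      by rewrite mulr_ge0 ?bary_ge0 // subr_ge0; case/andP: Ib.
    rewrite subr0 addr_ge0 ?bary_ge0 // !mulr_ge0 ?bary_ge0 //.
    by case/andP: Ib.
  - rewrite AP negb_or /u => /andP[vw' vs].
    rewrite xs // (negbTE vw') (_ : v == w = false) ?subrr ?mulr0 ?addr0 //.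
    by apply: contraNF vs => /eqP ->.
  - rewrite /u big_split /=.
    have -> : \sum_(v <- A) bary v (g p.1) = 1.
      rewrite -x1; apply/esym/big_fset_incl => [|v _ /xs //].
      exact: fsubsetUr.
    rewrite -big_distrr /= sumrB.
    have delta z : z \in A -> \sum_(v <- A) (v == z)%:R = 1 :> R.
      move=> zA; rewrite (big_fsetD1 z) //= eqxx big_seq big1 ?addr0 // => v.
      by rewrite !inE => /andP[/negbTE ->].
    by rewrite !delta // subrr mulr0 addr0.
have /choice[H HE] := uE.
have HE' p v : (I `*` I) p -> bary v (H p) = u v p.
  by move=> /HE /funeqP; exact.
have I0 : I 0 by apply/unitP; rewrite lexx ler01.
have I1 : I 1 by apply/unitP; rewrite lexx ler01.
have Hc : {within I `*` I, continuous H}.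
  apply: bary_within_continuous (fun _ _ => HE' _ _) => v.
  have gc' z : {within I `*` I, continuous (fun p => bary z (g p.1))}.
    apply: (@within_continuous_comp _ _ _ _ I (bary z \o g) fst).
    - by apply: continuous_subspaceT; exact: fst_continuous.
    - by move=> p [].
    - move=> a; apply: (@continuous_comp (subspace I) T R g (bary z)).
        exact: gc.
      exact: bary_continuous.
  rewrite /u => p; apply: cvgD; first exact: gc'.
  apply: cvgM; last exact: cvg_cst.
  apply: cvgM; last exact: gc'.
  have : {within I `*` I, continuous (snd : R * R -> R)}.
    by apply: continuous_subspaceT; exact: snd_continuous.
  exact.
have H01 b : I b -> H (0, b) = H (1, b).
  move=> Ib; apply: bary_inj; rewrite (HE (0, b)) // (HE (1, b)) //.
  by apply/funext => v; rewrite /u /= g01.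
exists (fun a => H (a, 1)); split.
- apply: (@within_continuous_comp _ _ _ _ (I `*` I) H (fun a => (a, 1))) => //.
  apply: continuous_subspaceT; apply: pair_continuous; last exact: cst_continuous.
  by move=> a; exact: cvg_id.
- exact: H01.
- move=> a v Ia; rewrite HE' // /u /= mul1r.
  have [->|vw'] := eqVneq v w'; first by right.
  have [->|vw] := eqVneq v w; first by rewrite sub0r mulrN1 subrr ltxx.
  by rewrite subrr mulr0 addr0 => /(gW _ _ Ia) vW; left.
exists H; split=> // a Ia; apply: bary_inj; rewrite HE //.
by apply/funext => v; rewrite /u /= !mul0r addr0.
Qed.

Variables (rank : V -> nat) (d : V -> V) (r : V).
Hypothesis rank_r : rank r = 0%N.
Hypothesis e_d : forall w, w != r -> e w (d w).
Hypothesis rank_d : forall w, w != r -> (rank (d w) < rank w)%N.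
Hypothesis dominated : forall w u, w != r -> e w u -> (rank u <= rank w)%N ->
  u = d w \/ e (d w) u.

(** By induction on the size of [W], a vertex [w] of maximal rank is folded onto [d w]. Maximality
    makes its neighbours in [W] dominated, and since [d] lowers the rank, no vertex of [W] other
    than [r] is sent to [w], so the rest of [W] stays closed under [d]. *)
Lemma dismantle_loop (x0 : T) (W : {fset V}) (g : R -> T) :
  (forall v, 0 < bary v x0 -> v = r) -> r \in W ->
  (forall w, w \in W -> w != r -> d w \in W) ->
  {within I, continuous g} -> g 0 = g 1 ->
  (forall a v, I a -> 0 < bary v (g a) -> v \in W) ->
  free_homotopic g (fun=> x0).
Proof.
move=> x0r; have [n] := ubnP #|` W|; elim: n W g => // n IH W g.
rewrite ltnS => Wn rW dW gc g01 gW.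
have [Wr|] := eqVneq W [fset r]%fset.
  have only_r (x : T) : (forall v, 0 < bary v x -> v = r) ->
      bary^~ x = (fun v => (v == r)%:R).
    move=> xr; have [s [_ _ x1] sP] := carried_support x.
    have sr : val s = [fset r]%fset.
      apply/eqP; have /is_cliqueP[s0 _] := valP s.
      have := fsubset1 (val s) r; rewrite (negbTE s0) orbF => <-.
      by apply/fsubsetP => v; rewrite sP inE => /xr ->.
    apply/funext => v; have [->|vr] := eqVneq v r.
      by rewrite sr big_seq_fset1 in x1.
    apply/eqP; rewrite eq_le bary_ge0 andbT leNgt -sP sr inE.
    exact: vr.
  exists (fun p => g p.1); split=> //.
  - apply: (@within_continuous_comp _ _ _ _ I g fst) => //.
      by apply: continuous_subspaceT; exact: fst_continuous.
    by move=> p [].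
  - move=> a Ia; apply: bary_inj; rewrite !only_r // => v /(gW _ _ Ia).
    by rewrite Wr inE => /eqP.
move=> Wr.
have [w0 w0W w0r] : exists2 w, w \in W & w != r.
  have : ~~ (W `<=` [fset r])%fset.
    rewrite fsubset1 negb_or Wr; apply/fset0Pn; by exists r.
  by case/fsubsetPn => w wW; rewrite inE => wr; exists w.
have [w [wW wr wmax]] : exists w, [/\ w \in W, w != r &
    forall u, u \in W -> (rank u <= rank w)%N].
  (* As [r] has rank 0, a maximum over the other vertices is a maximum over [W]. *)
  pose w : W := [arg max_(i > [` w0W]%fset | val i != r) rank (val i)].
  exists (val w); rewrite /w; case: arg_maxnP => //= i ir imax.
  split=> // u uW.
  have [->|ur] := eqVneq u r; first by rewrite rank_r.
  exact: (imax [` uW]%fset).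
have wdw : w != d w.
  by apply: contraTneq (rank_d wr) => <-; rewrite ltnn.
have [|g' [g'c g'01 g'W gg']] := fold_loop wdw (e_d wr) _ gc g01 gW.
  by move=> u uW ewu; apply: dominated => //; exact: wmax.
apply: free_homotopic_trans gg' _; apply: (IH (W `\ w)%fset) => //.
- by move: Wn; rewrite (cardfsD1 w) wW.
- by rewrite !inE eq_sym wr.
- move=> v; rewrite !inE => /andP[vw vW] vr; rewrite dW // andbT.
  by apply: contraTneq (rank_d vr) => ->; rewrite -leqNgt wmax.
- move=> a v Ia /(g'W _ _ Ia)[[vW vw]|->]; rewrite !inE; first by rewrite vw.
  by rewrite eq_sym wdw dW.
Qed.

Lemma orbit_closed v : exists2 s : seq V, v \in s &
  r \in s /\ forall w, w \in s -> w != r -> d w \in s.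
Proof.
have [n] := ubnP (rank v); elim: n v => // n IH v; rewrite ltnS => vn.
have [->|vr] := eqVneq v r.
  by exists [:: r]; rewrite ?inE //; split=> // w; rewrite !inE => ->.
have [s ds [rs sd]] := IH (d v) (leq_trans (rank_d vr) vn).
exists (v :: s); first exact: mem_head.
split=> [|w]; rewrite !inE; first by rewrite rs orbT.
by case/predU1P=> [->|ws] wr; rewrite ?ds ?orbT // sd ?orbT.
Qed.

(** The image of a loop is compact, hence supported on finitely many vertices; their finite orbits
    under [d] make up a finite set [W] closed under [d] and containing [r]. *)
Lemma dismantlable_simply_connected :
  connected [set: T] /\ simply_connected R T.
Proof.
have [|x0 x0E] := @carried_ex R V e
  (exist _ [fset r]%fset (is_clique1 e r) : X) (fun v => (v == r)%:R).
  split=> /= [v|v|].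
  - exact: ler0n.
  - by rewrite inE => /negbTE ->.
  - by rewrite big_seq_fset1 eqxx.
apply: (@contractible_loops R T x0) => g gc g01.
have [W0 W0P] : exists W : seq V, forall x v, (g @` I) x -> 0 < bary v x -> v \in W.
  apply: compact_finite_support; apply: continuous_compact => //.
  exact: segment_compact.
have /choice[n nP] : forall v, exists s : seq V, v \in s /\
  (r \in s /\ forall w, w \in s -> w != r -> d w \in s).
  by move=> v; have [s] := orbit_closed v; exists s.
have [W WP] : exists W : {fset V}, forall v,
    v \in W <-> exists2 u, u \in r :: W0 & v \in n u.
  exists (seq_fset tt (flatten (map n (r :: W0)))) => v; rewrite seq_fsetE.
  split=> [/flattenP[_ /mapP[u uW ->] vu]|[u uW vu]]; first by exists u.
  by apply/flattenP; exists (n u) => //; exact: map_f.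
apply: (@dismantle_loop x0 W) => //.
- move=> v; have /funeqP -> := x0E.
  by case: eqP => // _; rewrite ltxx.
- by apply/WP; exists r; rewrite ?mem_head //; case: (nP r).
- move=> w /WP[u uW wu] wr; apply/WP; exists u => //.
  by have [_ [_]] := nP u; exact.
- move=> a v Ia gv; apply/WP; exists v; last by case: (nP v).
  by rewrite inE (W0P (g a)) ?orbT //; exists a.
Qed.

End Dismantling.

(** * The action *)

Section CliqueAutomorphism.
Variables (V : choiceType) (e : rel V) (f f' : V -> V).
Hypotheses (fK : cancel f f') (f'K : cancel f' f).
Hypothesis f_e : forall v w, e v w -> e (f v) (f w).
Hypothesis f'_e : forall v w, e v w -> e (f' v) (f' w).
Let X := clique_complex e.

Lemma image_clique (h : V -> V) (s : {fset V}) :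
  (forall v w, e v w -> e (h v) (h w)) -> is_clique e s ->
  is_clique e [fset h x | x in s]%fset.
Proof.
move=> he /is_cliqueP[/fset0Pn[x xs] sc]; apply/is_cliqueP; split.
  by apply/fset0Pn; exists (h x); apply/imfsetP; exists x.
move=> _ _ /imfsetP[u us ->] /imfsetP[w ws ->] uw; apply: he; apply: sc => //.
by apply: contraNneq uw => ->.
Qed.

Definition image_simp (s : X) : X :=
  exist (is_clique e) [fset f x | x in val s]%fset (image_clique f_e (valP s)).

Definition image_vert (s : X) (v : vert s) : vert (image_simp s) :=
  [` in_imfset _ f (fsvalP (v : cvert s))]%fset.

Lemma image_simp_bij : bijective image_simp.
Proof.
exists (fun s : X =>
  exist (is_clique e) [fset f' x | x in val s]%fset (image_clique f'_e (valP s)) : X).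
  move=> s; apply/val_inj/fsetP => x /=; apply/imfsetP/idP => /= [[_ /imfsetP[y ys ->] ->]|xs].
    by rewrite fK.
  by exists (f x); rewrite ?fK //; apply/imfsetP; exists x.
move=> s; apply/val_inj/fsetP => x /=; apply/imfsetP/idP => /= [[_ /imfsetP[y ys ->] ->]|xs].
  by rewrite f'K.
by exists (f' x); rewrite ?f'K //; apply/imfsetP; exists x.
Qed.

Lemma image_vert_surj (s : X) (w : vert (image_simp s)) :
  exists v : vert s, w = image_vert v.
Proof.
have /imfsetP[x xs wx] := fsvalP (w : cvert (image_simp s)).
by exists ([` xs]%fset : cvert s); apply: val_inj.
Qed.

Lemma image_vert_bij (s : X) : bijective (@image_vert s).
Proof.
have /choice[g gK] := @image_vert_surj s.
exists g => [v|w]; last by rewrite -gK.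
by apply: val_inj; apply: (can_inj fK); have := congr1 val (gK (image_vert v)).
Qed.

Lemma image_att (s t : X) (h : {ffun vert s -> vert t})
    (h' : {ffun vert (image_simp s) -> vert (image_simp t)}) :
  (forall v, h' (image_vert v) = image_vert (h v)) -> att h' = att h.
Proof.
move=> hh'.
have eqP' : (image_simp s != image_simp t) = (s != t).
  by rewrite (inj_eq (bij_inj image_simp_bij)).
apply/cattP/cattP; rewrite eqP' => -[st H]; split=> // v.
  apply: (can_inj fK); have := H (image_vert v); rewrite hh'; exact.
by have [u ->] := image_vert_surj v; rewrite hh' /= H.
Qed.

Definition clique_automorphism : automorphism X :=
  Automorphism image_simp_bij image_vert_bij image_att.

(** Since coordinates determine points, this describes the action on the realisation without
    representatives. *)
Lemma bary_aut (R : realType) (x : realisation R X) v :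
  bary (f v) (aut_real clique_automorphism x) = bary v x.
Proof.
have [s [t ->]] := simplex_point_ex x.
rewrite /simplex_point aut_real_pi !bary_pi /coord /= /affine_fun.
rewrite [RHS](partition_big (@image_vert s)
  (fun w : cvert (image_simp s) => val w == f v)) /=; last by move=> w /eqP ->.
apply: eq_bigr => w /eqP wv; apply: eq_bigl => z.
rewrite andb_idl // => /eqP zw; apply/eqP; apply: (can_inj fK).
by rewrite -wv -zw.
Qed.
End CliqueAutomorphism.

Lemma existT_vert_eq (V : choiceType) (e : rel V) (x y : {s : clique_complex e & vert s}) :
  val (tag x) = val (tag y) ->
  val (tagged x : cvert (tag x)) = val (tagged y : cvert (tag y)) -> x = y.
Proof.
case: x y => [s v] [s' v'] /= /val_inj E; case: s' / E v' => v' E.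
congr existT; exact: val_inj.
Qed.

Section CompactSimplex.
Variable R : realType.

Lemma affine_simplex_compact (V : finType) : compact (affine_simplex R V).
Proof.
pose box := [set t : {ptws V -> R} | forall v, `[0%R, 1%R]%classic (t v)].
pose one := [set t : {ptws V -> R} | \sum_v t v = 1].
have -> : affine_simplex R V = box `&` one.
  apply/seteqP; split=> [t [t0 t1]|t [tb t1]]; split=> // v.
    rewrite /= in_itv /= t0 /= -t1 (bigD1 v) //= lerDl.
    exact: sumr_ge0.
  by have := tb v; rewrite /= in_itv /= => /andP[].
apply: compact_closedI.
  exact: (@tychonoff V (fun=> R) (fun=> `[0%R, 1%R]%classic) (fun=> @segment_compact R 0 1)).
apply: (@preimage_closed {ptws V -> R} R (fun t => \sum_v t v) [set 1]).
  move=> t _; move: t; apply: continuous_big => [|v _]; first exact: add_continuous.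
  exact: (@proj_continuous _ (fun=> R) v).
exact: closed_eq.
Qed.

Lemma simplex_point_compact (V : choiceType) (e : rel V) (s : clique_complex e) :
  compact (range (@simplex_point R V e s)).
Proof.
(* The total function [h] needs a value [x0] outside the simplex; if the realisation has no point,
   the range is empty. *)
have [[x0 _]|nT] := pselect (exists x : realisation R (clique_complex e), True); last first.
  rewrite (_ : range _ = set0); first exact: compact0.
  by apply/seteqP; split=> // x _; case: nT; exists x.
pose A := affine_simplex R (vert s).
pose h (t : {ptws vert s -> R}) : realisation R (clique_complex e) :=
  if pselect (A t) is left At then simplex_point (mk_affine At) else x0.
have hE (t : A) : h (val t) = simplex_point t.
  rewrite /h; case: pselect => [At|]; last by case; exact: set_mem (valP t).
  by congr simplex_point; exact: val_inj.
have -> : range (@simplex_point R V e s) = h @` A.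
  apply/seteqP; split=> [_ [t _ <-]|_ [t At <-]].
    by exists (val t); [exact: set_mem (valP t)|exact: hE].
  by exists (mk_affine At) => //; rewrite -hE.
apply: continuous_compact (@affine_simplex_compact (vert s)).
apply/subspace_sigL_continuousP.
have -> : sigL A h = @simplex_point R V e s by apply/funext => t; exact: hE.
exact: simplex_point_continuous.
Qed.
End CompactSimplex.

Section CliqueAction.
Variables (R : realType) (V : choiceType) (e : rel V) (G : groupType).
Variable op : G -> V -> V.
Hypothesis op1 : forall v, op 1%g v = v.
Hypothesis opM : forall g h v, op (g * h)%g v = op g (op h v).
Hypothesis op_e : forall g v w, e v w -> e (op g v) (op g w).
Let X := clique_complex e.

Let opK g : cancel (op g) (op g^-1%g).
Proof. by move=> v; rewrite -opM mulVg op1. Qed.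
Let opVK g : cancel (op g^-1%g) (op g).
Proof. by move=> v; rewrite -opM mulgV op1. Qed.

Definition clique_act (g : G) : automorphism X :=
  clique_automorphism (opK g) (opVK g) (op_e g) (op_e g^-1%g).

Fact clique_act1 x : aut_pair (clique_act 1%g) x = x.
Proof.
apply: existT_vert_eq; last exact: op1.
apply/fsetP => v /=; apply/imfsetP/idP => /= [[w ws ->]|vs]; first by rewrite op1.
by exists v; rewrite ?op1.
Qed.

Fact clique_actM g h x :
  aut_pair (clique_act (g * h)%g) x = aut_pair (clique_act g) (aut_pair (clique_act h) x).
Proof.
apply: existT_vert_eq; last exact: opM.
apply/fsetP => v /=; apply/imfsetP/imfsetP => /= [[w ws ->]|[_ /imfsetP[w ws ->] ->]].
  by exists (op h w); rewrite ?opM //; apply/imfsetP; exists w.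
by exists w; rewrite ?opM.
Qed.

Definition clique_action : simplicial_action G X :=
  SimplicialAction clique_act1 clique_actM.

Hypothesis e_fin : forall v, exists s : seq V, forall w, e v w -> w \in s.
Hypothesis op_free : forall g h v, op g v = op h v -> g = h.
Variable reps : seq V.
Hypothesis op_reps : forall v, exists g, exists2 r, r \in reps & op g r = v.

(** If [g] moves a point of [K] into [K], it moves some vertex of the finite set [W] into [W], and
    by freeness each such pair of vertices determines [g]. For cocompactness, the simplices
    containing a vertex of [reps] are finitely many and compact, and their translates cover. *)
Lemma clique_action_geometric : geometric R clique_action.
Proof.
split.
  move=> K Kc; have [W WK] := compact_finite_support e_fin Kc.
  pose S := \bigcup_(p in [set` [seq (v, w) | v <- W, w <- W]]) [set g | op g p.1 = p.2].
  apply: (@sub_finite_set _ _ S); last first.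
    apply: bigcup_finite; first exact: finite_seq.
    move=> [v w] _ /=; have [[g0 g0v]|ng] := pselect (exists g, op g v = w).
      apply: (@sub_finite_set _ _ [set g0]); last exact: finite_set1.
      by move=> g /= gv; apply: (@op_free _ _ v); rewrite gv.
    rewrite (_ : mkset _ = set0); first exact: finite_set0.
    by apply/seteqP; split=> // g gv; case: ng; exists g.
  move=> g [_ [[x Kx <-] Kgx]].
  have [s _ sP] := carried_support x.
  have [v vs] : exists v, v \in val s by apply/fset0Pn; case/is_cliqueP: (valP s).
  exists (v, op g v) => //=; apply: allpairs_f.
    by apply: WK Kx _; rewrite -sP.
  by apply: WK Kgx _; rewrite bary_aut -sP.
have /choice[n nP] := star_finite e_fin.
pose ss := flatten (map n reps).
exists (\big[setU/set0]_(s <- ss) range (@simplex_point R V e s)).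
  by apply: bigsetU_compact => s _; exact: simplex_point_compact.
apply/seteqP; split=> // x _.
have [s _ sP] := carried_support x.
have [v vs] : exists v, v \in val s by apply/fset0Pn; case/is_cliqueP: (valP s).
have [g [r rr grv]] := op_reps v.
exists g => //; exists (aut_real (clique_act g^-1%g) x); last first.
  apply: bary_inj; apply/funext => u.
  by rewrite -{1}(opVK g u) !bary_aut.
set y := aut_real _ x.
have [s' [_ ys _] s'P] := carried_support y.
have rs' : r \in val s'.
  by rewrite s'P -(opK g r) grv bary_aut -sP.
have [t -> _] := simplex_point_of_support ys.
rewrite -bigcup_seq; exists s'; last by exists t.
by apply/flattenP; exists (n r); [exact: map_f|exact: nP].
Qed.
End CliqueAction.

(** * The product of two free groups *)

Theorem corollary1p7 (R : realType) (F F' : groupType)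
    (freeF : free_group F) (fgF : finitely_generated F)
    (freeF' : free_group F') (fgF' : finitely_generated F') :
  systolic_group R (F * F')%type.
Proof.
have [bs [nf [nf_ok nf1 nfK nf_push]]] := finite_normal_form freeF fgF.
have [bs' [nf' [nf_ok' nf1' nfK' nf_push']]] := finite_normal_form freeF' fgF'.
pose t := cayley_tree nf_ok nf1 nfK nf_push.
pose t' := cayley_tree nf_ok' nf1' nfK' nf_push'.
(* By [cayley_level_odd] the Boolean of a tree vertex is its colour, so a pair of equal colour needs
   only one; [mk] takes it from its first argument. *)
pose V : choiceType := (F * F' * bool)%type.
pose p1 (v : V) : F * bool := (v.1.1, v.2).
pose p2 (v : V) : F' * bool := (v.1.2, v.2).
pose mk (s : F * bool) (s' : F' * bool) : V := (s.1, s'.1, s.2).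
have p_odd v : odd (level t (p1 v)) = odd (level t' (p2 v)).
  by rewrite !cayley_level_odd.
have mkK v : mk (p1 v) (p2 v) = v by case: v => [[]].
have mk1 s s' : odd (level t s) = odd (level t' s') -> p1 (mk s s') = s by case: s.
have mk2 s s' : odd (level t s) = odd (level t' s') -> p2 (mk s s') = s'.
  by rewrite !cayley_level_odd; case: s s' => [x c] [y c'] /= ->.
pose e := product_adj t t' p1 p2.
have e_sym : symmetric e := product_adj_sym t t' p1 p2.
have e_fin := product_adj_finite t t' mkK.
pose op (g : F * F') (v : V) : V := ((g.1 * v.1.1)%g, (g.2 * v.1.2)%g, v.2).
have op_e g v w : e v w -> e (op g v) (op g w).
  move=> /product_adjP H; apply/product_adjP.
  have adj_l (x y : F * bool) : cayley_adj bs x y ->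
      cayley_adj bs ((g.1 * x.1)%g, x.2) ((g.1 * y.1)%g, y.2).
    by rewrite (cayley_adj_left bs g.1).
  have adj_r (x y : F' * bool) :
      cayley_adj bs' x y ->
      cayley_adj bs' ((g.2 * x.1)%g, x.2) ((g.2 * y.1)%g, y.2).
    by rewrite (cayley_adj_left bs' g.2).
  case: H => [[/adj_l a1 /adj_r a2]|[E N [m /adj_l vm /adj_l mw]]].
    by left.
  right; split.
  - by case: E => E1 E2; rewrite /p2 /= E1 E2.
  - by move=> [/mulgI E1 E2]; apply: N; rewrite /p1 E1 E2.
  - by exists ((g.1 * m.1)%g, m.2).
exists (clique_complex e).
  have [rank [d [r [rank_r e_d rank_d dom]]]] := product_dismantling p_odd mkK mk1 mk2.
  have [conn sc] := @dismantlable_simply_connected R V e e_fin e_sym rank d r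
    rank_r e_d rank_d dom.
  split=> //.
    exact: (inhabits (exist _ [fset r]%fset (is_clique1 e r) : clique_complex e)).
  apply: clique_locally_6_large => //; first exact: product_adj_irr.
  move=> v n u; exact: product_link_large.
have op1 v : op 1%g v = v by case: v => [[x y] c]; rewrite /op /= !mul1g.
have opM g h v : op (g * h)%g v = op g (op h v).
  by case: g h v => [g1 g2] [h1 h2] [[x y] c]; rewrite /op /= !mulgA.
exists (clique_action op1 opM op_e).
(* Translations keep the colour and are transitive on each colour, so the identity in the two
   colours represents all orbits; freeness is cancellation. *)
apply: (@clique_action_geometric R V e _ op op1 opM op_e e_fin _
  [:: (1%g, 1%g, false); (1%g, 1%g, true)]).
  move=> [g1 g2] [h1 h2] [[x y] c]; rewrite /op /=.
  by move=> [/mulIg -> /mulIg ->].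
move=> [[x y] c]; exists (x, y), (1%g, 1%g, c); first by case: c; rewrite !inE eqxx ?orbT.
by rewrite /op /= !mulg1.
Qed.
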